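(* Let $(N,J,\nabla,\xi)$ be a conical special complex manifold and set $Z:=J\xi$. Equip the tangent bundle $TN$ with its canonical hypercomplex structure $(I_1,I_2,I_3)$. Then the vector field $2Z^{h_\nabla}$ is a rotating vector field on $TN$, that is, $L_{2Z^{h_\nabla}}I_1=0$ and $L_{2Z^{h_\nabla}}I_2=-2I_3$.
   Context: A special complex manifold $(N,J,\nabla)$ is a complex manifold $(N,J)$ with a torsion-free flat connection $\nabla$ such that $\nabla J$ is symmetric, i.e. $(\nabla_XJ)Y=(\nabla_YJ)X$. A conical special complex manifold $(N,J,\nabla,\xi)$ is a special complex manifold with a vector field $\xi$ such that $\nabla\xi=\mathrm{id}$ and $L_\xi J=0$. $X^{h_\nabla}$ and $X^v$ denote the $\nabla$-horizontal and vertical lifts to $TN$ of $X\in TN$. The canonical hypercomplex structure on $TN$ is $I_1(X^{h_\nabla}+Y^v)=(JX)^{h_\nabla}-(JY)^v$, $I_2(X^{h_\nabla}+Y^v)=Y^{h_\nabla}-X^v$, $I_3(X^{h_\nabla}+Y^v)=(JY)^{h_\nabla}+(JX)^v$. *)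

(* Defs.v *)
From HB Require Import structures.
From mathcomp Require Import all_boot all_order all_algebra.
From mathcomp Require Import all_classical all_reals all_analysis.

Set Implicit Arguments.
Unset Strict Implicit.
Unset Printing Implicit Defensive.

Import Order.TTheory GRing.Theory Num.Theory.
Import numFieldNormedType.Exports.

Local Open Scope classical_set_scope.
Local Open Scope ring_scope.

Section smooth_maps.
Context {R : realType} {V W : normedModType R}.

Fixpoint iter_derive (vs : seq V) (f : V -> W) : V -> W :=
  if vs is v :: vs' then iter_derive vs' ('D_v f) else f.

(* C^oo on A; only meant for open A (every iterated directional derivative
   exists and is Frechet differentiable at the points of A). *)
Definition smooth_on (A : set V) (f : V -> W) : Prop :=
  forall (vs : seq V) (x : V), A x -> differentiable (iter_derive vs f) x.

End smooth_maps.

(* A set with an atlas of charts [chart i : dom i -> R^n], whose inverses are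
   [param i]; both are total functions, irrelevant outside [dom i] and its
   image.  [pref p] is a chart around p, used to represent the tangent space
   T_p N by R^n: a tangent vector at p *is* its vector of components in the
   chart [pref p]. *)
Record chart_space (R : realType) (n : nat) := ChartSpace {
  point :> Type;
  index : Type;
  dom : index -> set point;
  chart : index -> point -> 'rV[R]_n;
  param : index -> 'rV[R]_n -> point;
  pref : point -> index }.

Section manifolds.
Context {R : realType} {n : nat}.
Implicit Type N : chart_space R n.

(* The topology induced by the atlas. *)
Definition atlas_open N (U : set N) : Prop :=
  forall i : index N, open (chart i @` (U `&` dom i)).

Record smooth_manifold N : Prop := {
  manifold_pref : forall p : N, dom (pref p) p;
  manifold_paramK : forall (i : index N) (p : N),
    dom i p -> param i (chart i p) = p;
  manifold_open : forall i j : index N,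
    open (chart i @` (dom i `&` dom j));
  manifold_transition : forall i j : index N,
    smooth_on (chart i @` (dom i `&` dom j)) (chart j \o param i);
  manifold_hausdorff : forall p q : N, p <> q ->
    exists U V : set N, [/\ atlas_open U, atlas_open V, U p, V q &
                            U `&` V = set0];
  manifold_second_countable : exists B : nat -> set N,
    (forall k, atlas_open (B k)) /\
    (forall (U : set N) (p : N), atlas_open U -> U p ->
       exists2 k, B k p & B k `<=` U) }.

(* [vector_field N] and [endo_field N] are not necessarily smooth sections of
   TN and of End(TN) (linearity is not imposed either). *)
Definition vector_field N := N -> 'rV[R]_n.
Definition endo_field N := N -> 'rV[R]_n -> 'rV[R]_n.

(* Components in the chart i of v in T_p N (for p in [dom i]), i.e. the image
   of v under the Jacobian of the transition from [pref p] to i. *)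
Definition tcoord N (i : index N) (p : N) (v : 'rV[R]_n) : 'rV[R]_n :=
  'D_v (chart i \o param (pref p)) (chart (pref p) p).

Definition local_rep N (i : index N) (X : vector_field N) :
    'rV[R]_n -> 'rV[R]_n :=
  fun x => tcoord i (param i x) (X (param i x)).

Definition smooth_function N (U : set N) (f : N -> R) : Prop :=
  forall i : index N,
    smooth_on (chart i @` (U `&` dom i)) (f \o param i : _ -> R).

Definition smooth_field N (U : set N) (X : vector_field N) : Prop :=
  forall i : index N, smooth_on (chart i @` (U `&` dom i)) (local_rep i X).

(* The derivative v(f) of f along v in T_p N. *)
Definition dfun N (f : N -> R) (p : N) (v : 'rV[R]_n) : R :=
  'D_v (f \o param (pref p)) (chart (pref p) p).

(* [X, Y]^k = X^i d_i Y^k - Y^i d_i X^k at p, computed in [pref p]. *)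
Definition lie_bracket N (X Y : vector_field N) : vector_field N :=
  fun p => 'D_(X p) (local_rep (pref p) Y) (chart (pref p) p)
         - 'D_(Y p) (local_rep (pref p) X) (chart (pref p) p).

Definition app_field N (A : endo_field N) (X : vector_field N) :
  vector_field N := fun p => A p (X p).

(* (L_X A) Y = [X, A Y] - A [X, Y] *)
Definition lie_derivative N (X : vector_field N) (A : endo_field N)
    (Y : vector_field N) : vector_field N :=
  fun p => lie_bracket X (app_field A Y) p - A p (lie_bracket X Y p).

(* L_X A = B as tensor fields, tested on all local smooth vector fields. *)
Definition lie_derivative_is N (X : vector_field N) (A B : endo_field N) :
    Prop :=
  forall (U : set N) (Y : vector_field N) (p : N),
    atlas_open U -> smooth_field U Y -> U p ->
    lie_derivative X A Y p = B p (Y p).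

End manifolds.

Section connections.
Context {R : realType} {n : nat} (N : chart_space R n).

(* An affine connection is given on local fields: [nabla Y p v] is the
   covariant derivative of Y at p in the direction v, meaningful when Y is
   smooth near p.  The axioms hold over every open set, so that they contain
   the locality of nabla. *)
Definition covariant := vector_field N -> N -> 'rV[R]_n -> 'rV[R]_n.

Definition cov (nabla : covariant) (X Y : vector_field N) : vector_field N :=
  fun p => nabla Y p (X p).

Record connection (nabla : covariant) : Prop := {
  connection_linear : forall (U : set N) (Y : vector_field N) (p : N),
    atlas_open U -> smooth_field U Y -> U p ->
    forall (a : R) (v w : 'rV[R]_n),
      nabla Y p (a *: v + w) = a *: nabla Y p v + nabla Y p w;
  connection_add : forall (U : set N) (Y Y' : vector_field N) (p : N),
    atlas_open U -> smooth_field U Y -> smooth_field U Y' -> U p ->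
    forall v : 'rV[R]_n,
      nabla (fun q => Y q + Y' q) p v = nabla Y p v + nabla Y' p v;
  connection_leibniz : forall (U : set N) (f : N -> R) (Y : vector_field N)
      (p : N),
    atlas_open U -> smooth_function U f -> smooth_field U Y -> U p ->
    forall v : 'rV[R]_n,
      nabla (fun q => f q *: Y q) p v = dfun f p v *: Y p + f p *: nabla Y p v;
  connection_smooth : forall (U : set N) (X Y : vector_field N),
    atlas_open U -> smooth_field U X -> smooth_field U Y ->
    smooth_field U (cov nabla X Y) }.

Definition torsion_free (nabla : covariant) : Prop :=
  forall (U : set N) (X Y : vector_field N) (p : N),
    atlas_open U -> smooth_field U X -> smooth_field U Y -> U p ->
    cov nabla X Y p - cov nabla Y X p - lie_bracket X Y p = 0.

Definition flat (nabla : covariant) : Prop :=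
  forall (U : set N) (X Y Z : vector_field N) (p : N),
    atlas_open U -> smooth_field U X -> smooth_field U Y ->
    smooth_field U Z -> U p ->
    cov nabla X (cov nabla Y Z) p - cov nabla Y (cov nabla X Z) p
      - cov nabla (lie_bracket X Y) Z p = 0.

(* (nabla_X A) Y = nabla_X (A Y) - A (nabla_X Y) *)
Definition cov_endo (nabla : covariant) (A : endo_field N)
    (X Y : vector_field N) : vector_field N :=
  fun p => cov nabla X (app_field A Y) p - A p (cov nabla X Y p).

End connections.

Section special_complex.
Context {R : realType} {m : nat} (N : chart_space R (m + m)).

(* Multiplication by i on C^m = R^m + R^m, x + i y being (x, y). *)
Definition mul_i (v : 'rV[R]_(m + m)) : 'rV[R]_(m + m) :=
  row_mx (- rsubmx v) (lsubmx v).

(* J is multiplication by i in every chart; in particular the transition maps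
   satisfy the Cauchy-Riemann equations, i.e. the atlas is holomorphic. *)
Record complex_manifold (J : endo_field N) : Prop := {
  complex_manifold_smooth : smooth_manifold N;
  complex_manifold_J : forall (i : index N) (p : N) (v : 'rV[R]_(m + m)),
    dom i p -> tcoord i p (J p v) = mul_i (tcoord i p v) }.

Record special_complex_manifold (J : endo_field N) (nabla : covariant N) :
    Prop := {
  special_complex : complex_manifold J;
  special_connection : connection nabla;
  special_torsion_free : torsion_free nabla;
  special_flat : flat nabla;
  special_symmetric : forall (U : set N) (X Y : vector_field N) (p : N),
    atlas_open U -> smooth_field U X -> smooth_field U Y -> U p ->
    cov_endo nabla J X Y p = cov_endo nabla J Y X p }.

Record conical_special_complex_manifold (J : endo_field N)
    (nabla : covariant N) (xi : vector_field N) : Prop := {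
  conical_special : special_complex_manifold J nabla;
  conical_smooth : smooth_field setT xi;
  conical_nabla : forall (p : N) (v : 'rV[R]_(m + m)), nabla xi p v = v;
  conical_lie : lie_derivative_is xi J (fun _ _ => 0) }.

End special_complex.

Section tangent_bundle.
Context {R : realType} {n : nat} (N : chart_space R n).

(* The total space of TN with its induced charts (q, w) |-> (x^k, w^k).  The
   tangent space at u = (p, w) is represented by R^n + R^n through the chart
   induced by [pref p]: (a, b) stands for a^k d/dx^k + b^k d/dw^k. *)
Definition tangent_bundle : chart_space R (n + n) := {|
  point := (point N * 'rV[R]_n)%type;
  index := index N;
  dom := fun i => [set u | dom i u.1];
  chart := fun i u => row_mx (chart i u.1) (tcoord i u.1 u.2);
  param := fun i z =>
    let q := param i (lsubmx z) in
    (q, 'D_(rsubmx z) (chart (pref q) \o param i) (lsubmx z));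
  pref := fun u => pref u.1 |}.

(* The field on [dom i] with constant components w in the chart i. *)
Definition coord_field (i : index N) (w : 'rV[R]_n) : vector_field N :=
  fun q => 'D_w (chart (pref q) \o param i) (chart i q).

Variable nabla : covariant N.

(* v^i w^j Gamma_ij^k at p, with the Christoffel symbols of [pref p]. *)
Definition christoffel (p : N) (v w : 'rV[R]_n) : 'rV[R]_n :=
  nabla (coord_field (pref p) w) p v.

(* Lifts to T_u(TN) of X in T_(pi u) N:
   X^h = X^k d/dx^k - X^i w^j Gamma_ij^k d/dw^k  and  X^v = X^k d/dw^k. *)
Definition hlift (u : tangent_bundle) (X : 'rV[R]_n) : 'rV[R]_(n + n) :=
  row_mx X (- christoffel u.1 X u.2).

Definition vlift (u : tangent_bundle) (X : 'rV[R]_n) : 'rV[R]_(n + n) :=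
  row_mx 0 X.

(* The X and Y of the decomposition A = X^h + Y^v of A in T_u(TN). *)
Definition hpart (u : tangent_bundle) (A : 'rV[R]_(n + n)) : 'rV[R]_n :=
  lsubmx A.

Definition vpart (u : tangent_bundle) (A : 'rV[R]_(n + n)) : 'rV[R]_n :=
  rsubmx (A - hlift u (hpart u A)).

Lemma hvpartK u A : hlift u (hpart u A) + vlift u (vpart u A) = A.
Proof.
rewrite /vlift /vpart linearB /= /hlift row_mxKr /hpart add_row_mx addr0.
by rewrite addrC subrK hsubmxK.
Qed.

Lemma hpartE u X Y : hpart u (hlift u X + vlift u Y) = X.
Proof. by rewrite /hpart add_row_mx row_mxKl addr0. Qed.

Lemma vpartE u X Y : vpart u (hlift u X + vlift u Y) = Y.
Proof.
by rewrite /vpart hpartE addrC addKr row_mxKr.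
Qed.

Variable J : endo_field N.

Definition hyper1 : endo_field tangent_bundle := fun u A =>
  hlift u (J u.1 (hpart u A)) - vlift u (J u.1 (vpart u A)).

Definition hyper2 : endo_field tangent_bundle := fun u A =>
  hlift u (vpart u A) - vlift u (hpart u A).

Definition hyper3 : endo_field tangent_bundle := fun u A =>
  hlift u (J u.1 (vpart u A)) + vlift u (J u.1 (hpart u A)).

Lemma hyper1E u X Y : hyper1 u (hlift u X + vlift u Y) =
  hlift u (J u.1 X) - vlift u (J u.1 Y).
Proof. by rewrite /hyper1 hpartE vpartE. Qed.

Lemma hyper2E u X Y : hyper2 u (hlift u X + vlift u Y) =
  hlift u Y - vlift u X.
Proof. by rewrite /hyper2 hpartE vpartE. Qed.

Lemma hyper3E u X Y : hyper3 u (hlift u X + vlift u Y) =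
  hlift u (J u.1 Y) + vlift u (J u.1 X).
Proof. by rewrite /hyper3 hpartE vpartE. Qed.

Definition hlift_field (X : vector_field N) : vector_field tangent_bundle :=
  fun u => hlift u (X u.1).

End tangent_bundle.

Arguments hlift {R n N} nabla u X.
Arguments vlift {R n N} u X.

Definition rotating_vector_field (R : realType) (n : nat)
    (M : chart_space R n) (I1 I2 I3 : endo_field M) (X : vector_field M) :
    Prop :=
  [/\ smooth_field setT X,
      lie_derivative_is X I1 (fun _ _ => 0) &
      lie_derivative_is X I2 (fun u A => - (2 *: I3 u A))].

(* Main.v *)
(* Work in a holomorphic chart, where J is the constant mul_i, and write Gamma
   for the Christoffel symbols of nabla.  Symmetry of nabla J and vanishing
   torsion give Gamma(a, J b) = Gamma(J a, b); with L_xi J = 0 and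
   nabla xi = id this yields nabla Z = J and nabla_Z J = 0 = L_Z J.
   On TN a vector field is X^h + V^v, X and V being vectors of N depending on
   the point (x, w) of TN, and flatness cancels all derivatives of Gamma in
     [Z^h, X^h + V^v] = (D_(Z^h) X - D_X Z)^h + (D_(Z^h) V + Gamma(Z, V))^v.
   Since I_1 and I_2 replace (X, V) by (J X, - J V) and (V, - X), both Lie
   derivatives follow from this formula. *)

Require Import Defs.
From HB Require Import structures.
From mathcomp Require Import all_boot all_order all_algebra.
From mathcomp Require Import all_classical all_reals all_analysis.
From mathcomp Require Import lra.
Set Implicit Arguments.
Unset Strict Implicit.
Unset Printing Implicit Defensive.
Import Order.TTheory GRing.Theory Num.Theory.
Import numFieldNormedType.Exports.
Local Open Scope classical_set_scope.
Local Open Scope ring_scope.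

(** The Lie derivatives are tested on every local smooth field of TN, so lifts of fields on N do not
    suffice: X and V must depend on the fibre coordinate w, and they are read off an arbitrary field
    by splitting it. In the bracket, the derivatives of Gamma and its quadratic terms form the
    curvature applied to w, which is why flatness removes them. For I_1, the maps D_(Z^h), X |-> D_X
    Z and V |-> Gamma(Z, V) commute with J. For I_2, the D_(Z^h) terms cancel; what is left is -
    (D_v Z + Gamma(Z, v)) = - nabla_v Z = - J v, with v = V in the horizontal slot and v = X in the
    vertical one, and this is - I_3. The factor 2 is only the normalisation of 2 Z^h. A second
    obstacle is the encoding: components at p refer to the chart [pref p], which may jump from point
    to point, so nothing can be differentiated through [pref]. Derivatives are taken in one fixed
    chart, and [pref] is eliminated by the chain rule for transitions. *)

(** * Frechet derivatives *)

Section raw_linear.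
Context {R : pzRingType} {V W : lmodType R} {f : V -> W}.
Hypothesis fl : linear f.

(** Linearity of the maps in play ([tcoord i p], derivatives, [nabla Y p]) depends on hypotheses
    such as [dom i p], so the rules are stated for a function with a bare proof of [linear f]. *)
Lemma linear_onD u v : f (u + v) = f u + f v.
Proof. by have := fl 1 u v; rewrite !scale1r. Qed.

Lemma linear_on0 : f 0 = 0.
Proof. by apply: (addrI (f 0)); rewrite -linear_onD !addr0. Qed.

Lemma linear_onZ a v : f (a *: v) = a *: f v.
Proof. by rewrite -[a *: v]addr0 fl linear_on0 addr0. Qed.

Lemma linear_onN v : f (- v) = - f v.
Proof. by rewrite -scaleN1r linear_onZ scaleN1r. Qed.

Lemma linear_onB u v : f (u - v) = f u - f v.
Proof. by rewrite linear_onD linear_onN. Qed.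

Lemma linear_on_sum I (r : seq I) (P : pred I) (F : I -> V) :
  f (\sum_(i <- r | P i) F i) = \sum_(i <- r | P i) f (F i).
Proof. exact: (big_morph f linear_onD linear_on0). Qed.

End raw_linear.

Section calculus.
Context {R : realType}.
Implicit Types U V W : normedModType R.

Lemma is_diff_differentiable V W (f df : V -> W) (x : V) :
  is_diff x f df -> differentiable f x.
Proof. by case. Qed.

Lemma is_diff_derive V W (f df : V -> W) (x v : V) :
  is_diff x f df -> 'D_v f x = df v.
Proof. by move=> dfx; rewrite deriveE ?diff_val //; exact: ex_diff. Qed.

Lemma derive_is_diff V W (f : V -> W) (x : V) :
  differentiable f x -> is_diff x f (fun v => 'D_v f x).
Proof. by move=> df; split=> //; apply/funext => v; rewrite deriveE. Qed.

Lemma derive_linear V W (f : V -> W) (x : V) : differentiable f x ->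
  linear (fun v => 'D_v f x).
Proof. by move=> df a u v; rewrite !deriveE // linearP. Qed.

Lemma scale_is_bilinear W :
  bilinear_for
    (GRing.Scale.Law.clone _ _ *:%R _) (GRing.Scale.Law.clone _ _ *:%R _)
    (@GRing.scale R W).
Proof.
split => [u'|u] a x y /=.
- by rewrite scalerDl scalerA.
- by rewrite scalerDr !scalerA mulrC.
Qed.

Lemma is_diff_scale V W (f df : V -> R) (g dg : V -> W) (x : V) :
  is_diff x f df -> is_diff x g dg ->
  is_diff x (fun z => f z *: g z) (fun v => f x *: dg v + df v *: g x).
Proof.
move=> hf hg.
(* Scaling is packed as a continuous bilinear map; the product rule is then the chain rule. *)
pose sM := bilinear_isBilinear.Build R R W W _ _ _ (@scale_is_bilinear W).
pose s : {bilinear R -> W -> W} := HB.pack (@GRing.scale R W) sM.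
have sc : continuous (fun p : R * W => s p.1 p.2) by exact: scale_continuous.
have hs : is_diff (f x, g x) (fun p : R * W => s p.1 p.2)
    (fun q => f x *: q.2 + q.1 *: g x).
  by split; [exact: differentiable_bilin|rewrite diff_bilin].
exact: (is_diff_comp (is_diff_pair hf hg) hs).
Qed.

(** Chart identities hold only on chart domains, so differentials are transported along local
    equality: [g - f] vanishes near [x], hence has differential 0, and is added to [f]. *)
Lemma near_is_diff V W (f g df : V -> W) (x : V) :
  (\near x, f x = g x) -> is_diff x f df -> is_diff x g df.
Proof.
move=> fg hf.
have hh : is_diff x (g - f) 0.
  have h0 : \forall y \near x, (g - f) y = 0.
    by near=> y; rewrite -[LHS]/(g y - f y) (near fg y) // subrr.
  have gx : (g - f) x = 0 by exact: (nbhs_singleton h0).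
  have c0 : continuous (0 : V -> W) /\
      (g - f) \o shift x = cst ((g - f) x) + (0 : V -> W) +o_ 0 id.
    split; first exact: cst_continuous.
    apply/eqaddoP => _/posnumP[e].
    have sx : (fun y : V => y + x) @ (0 : V) --> x.
      rewrite -[X in _ --> X]add0r.
      by apply: (@cvgD _ V V (nbhs (0 : V)) _ idfun (cst x) 0 x);
        [exact: cvg_id|exact: cvg_cst].
    have h1 : \forall y \near (0 : V), (g - f) (y + x) = 0 by exact: (sx _ h0).
    near=> y; have hy : (g - f) (y + x) = 0 by near: y.
    rewrite -[X in `|X|]/((g - f) (y + x) - ((g - f) x + 0)) hy gx addr0.
    by rewrite subrr normr0 mulr_ge0.
  have d0 : 'd (g - f) x = (0 : V -> W) :> (V -> W).
    by apply: (@diff_unique _ _ _ _ (\0 : {linear V -> W}%R)); case: c0.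
  by split=> //; apply/diff_locallyP; rewrite d0.
have := is_diffD hf hh.
by rewrite addrC subrK addr0.
Unshelve. all: by end_near. Qed.

Lemma is_diff_sum V W n (f df : 'I_n -> V -> W) (x : V) :
  (forall k, is_diff x (f k) (df k)) ->
  is_diff x (fun z => \sum_(k < n) f k z) (fun v => \sum_(k < n) df k v).
Proof.
move=> hf.
have E (g : 'I_n -> V -> W) : (fun z => \sum_(k < n) g k z) = \sum_(k < n) g k.
  by apply/funext => z; rewrite fct_sumE.
rewrite !E; apply: (big_ind2 (fun f df => is_diff x f df)) => //.
- exact: is_diff_cst.
- by move=> f1 df1 f2 df2; exact: is_diffD.
Qed.

Section row_vectors.
Context {n : nat} {W : normedModType R}.

Lemma linear_coord_sum (f : 'rV[R]_n -> W) (v : 'rV[R]_n) : linear f ->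
  f v = \sum_(k < n) v 0 k *: f 'e_k.
Proof.
move=> fl; rewrite [in LHS](row_sum_delta v) (linear_on_sum fl).
by apply: eq_bigr => k _; rewrite (linear_onZ fl).
Qed.

(** Finite dimension supplies continuity: the map is a finite sum of coordinates times fixed
    vectors. *)
Lemma rV_linear_is_diff (f : 'rV[R]_n -> W) (x : 'rV[R]_n) :
  linear f -> is_diff x f f.
Proof.
move=> fl.
pose fL : {linear 'rV[R]_n -> W} :=
  HB.pack f (GRing.isLinear.Build _ _ _ _ f fl).
have df y : differentiable f y.
  have -> : f = (fun v => \sum_(k < n) v 0 k *: f 'e_k).
    by apply/funext => v; exact: linear_coord_sum.
  apply: is_diff_differentiable; apply: is_diff_sum => k.
  by apply/derive_is_diff/differentiableZl/differentiable_coord.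
have fc : continuous fL by move=> y; exact: differentiable_continuous.
split; first exact: df.
exact: (diff_lin x fc).
Qed.

Lemma is_diff_linear_comp V (f : 'rV[R]_n -> W) (g dg : V -> 'rV[R]_n) (x : V) :
  linear f -> is_diff x g dg -> is_diff x (f \o g) (f \o dg).
Proof.
by move=> fl hg; apply: is_diff_comp; exact: rV_linear_is_diff.
Qed.

End row_vectors.

Lemma coord_linear n (k : 'I_n) : linear (fun v : 'rV[R]_n => v 0 k : R).
Proof. by move=> a u v; rewrite !mxE. Qed.

Lemma is_diff_coord V n (f df : V -> 'rV[R]_n) (x : V) (k : 'I_n) :
  is_diff x f df -> is_diff x (fun z => f z 0 k : R) (fun v => df v 0 k).
Proof. by move=> hf; exact: (is_diff_linear_comp (@coord_linear n k)). Qed.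

Lemma lsubmx_linear n1 n2 :
  linear (lsubmx : 'rV[R]_(n1 + n2) -> 'rV[R]_n1).
Proof. by move=> a u v; rewrite linearP. Qed.

Lemma rsubmx_linear n1 n2 :
  linear (rsubmx : 'rV[R]_(n1 + n2) -> 'rV[R]_n2).
Proof. by move=> a u v; rewrite linearP. Qed.

Lemma is_diff_row_mx V n1 n2 (f df : V -> 'rV[R]_n1) (g dg : V -> 'rV[R]_n2)
    (x : V) : is_diff x f df -> is_diff x g dg ->
  is_diff x (fun z => row_mx (f z) (g z)) (fun v => row_mx (df v) (dg v)).
Proof.
move=> hf hg.
have l1 : linear (fun a : 'rV[R]_n1 => row_mx a (0 : 'rV[R]_n2)).
  by move=> a u v; rewrite scale_row_mx add_row_mx scaler0 addr0.
have l2 : linear (fun a : 'rV[R]_n2 => row_mx (0 : 'rV[R]_n1) a).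
  by move=> a u v; rewrite scale_row_mx add_row_mx scaler0 addr0.
have := is_diffD (is_diff_linear_comp l1 hf) (is_diff_linear_comp l2 hg).
congr is_diff_def; apply/funext => z /=;
  by rewrite -[LHS]/(row_mx _ _ + row_mx _ _) add_row_mx addr0 add0r.
Qed.

End calculus.

(** * Smooth maps *)

Section smooth_calculus.
Context {R : realType}.
Implicit Types U V W : normedModType R.

(** [smooth_on] graded by order: derivatives iterated at most [k] times are differentiable on [A].
    The grading allows induction on [k] through the Leibniz and chain rules. *)
Fixpoint C_on V W (k : nat) (A : set V) (f : V -> W) : Prop :=
  (forall x, A x -> differentiable f x) /\
  if k is k'.+1 then forall v, C_on k' A ('D_v f) else True.

Lemma smooth_onP V W (A : set V) (f : V -> W) :
  smooth_on A f <-> forall k, C_on k A f.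
Proof.
split => [sf k|cf vs x Ax].
- elim: k f sf => [|k ih] f sf /=.
    by split=> // x Ax; exact: (sf [::]).
  split; first by move=> x Ax; exact: (sf [::]).
  by move=> v; apply: ih => vs; exact: (sf (v :: vs)).
- elim: vs f cf => [|v vs ih] f cf /=; first by have [+ _] := cf 0; exact.
  by apply: ih => k; have [_] := cf k.+1; exact.
Qed.

Lemma smooth_on_differentiable V W (A : set V) (f : V -> W) x :
  smooth_on A f -> A x -> differentiable f x.
Proof. by move=> sf; exact: (sf [::]). Qed.

Lemma C_on_differentiable V W k (A : set V) (f : V -> W) x :
  C_on k A f -> A x -> differentiable f x.
Proof. by case: k => [|k] [df _]; exact: df. Qed.

Lemma C_onS V W k (A : set V) (f : V -> W) : C_on k.+1 A f -> C_on k A f.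
Proof.
elim: k f => [|k ih] f [df dDf]; first by split.
by split=> // v; exact/ih/dDf.
Qed.

Lemma smooth_on_derive V W (A : set V) (f : V -> W) v :
  smooth_on A f -> smooth_on A ('D_v f).
Proof. by move=> sf vs; exact: (sf (v :: vs)). Qed.

Lemma smooth_on_sub V W (A B : set V) (f : V -> W) :
  A `<=` B -> smooth_on B f -> smooth_on A f.
Proof. by move=> AB sf vs x /AB; exact: sf. Qed.

(** * Closure properties of smoothness on an open set *)

Section open_domain.
Context {V : normedModType R} {A : set V} (oA : open A).

Lemma near_open x : A x -> \forall y \near x, A y.
Proof. by move=> Ax; apply: open_nbhs_nbhs; split. Qed.

Lemma C_on_ext W k (f g : V -> W) :
  (forall x, A x -> f x = g x) -> C_on k A f -> C_on k A g.
Proof.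
have nfg f' g' : (forall x, A x -> f' x = g' x) ->
    forall x, A x -> \forall y \near x, f' y = g' y :> W.
  by move=> fg x Ax; apply: filterS (near_open Ax) => y; exact: fg.
have dfg f' g' : (forall x, A x -> f' x = g' x) ->
    (forall x, A x -> differentiable f' x) ->
    (forall x, A x -> differentiable (g' : V -> W) x).
  move=> fg df x Ax; apply: is_diff_differentiable.
  by apply: near_is_diff (nfg _ _ fg _ Ax) _; apply/derive_is_diff/df.
elim: k f g => [|k ih] f g fg [df dDf]; split => //; try exact: (dfg f g).
by move=> v; apply: ih (dDf v) => x Ax; exact/near_eq_derive/nfg.
Qed.

Lemma C_on_cst W k (c : W) : C_on k A (cst c).
Proof.
elim: k c => [|k ih] c; split => //; try by move=> x _; exact: differentiable_cst.
by move=> v; apply: C_on_ext (ih 0) => x _; rewrite derive_cst.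
Qed.

Lemma C_onD W k (f g : V -> W) :
  C_on k A f -> C_on k A g -> C_on k A (fun x => f x + g x).
Proof.
elim: k f g => [|k ih] f g cf cg.
  split=> // x Ax; apply: differentiableD.
    exact: C_on_differentiable cf Ax.
  exact: C_on_differentiable cg Ax.
split=> [x Ax|v].
  by apply: differentiableD; [exact: C_on_differentiable cf Ax
                             |exact: C_on_differentiable cg Ax].
apply: C_on_ext (ih _ _ (cf.2 v) (cg.2 v)) => x Ax.
apply/esym.
have df := C_on_differentiable cf Ax; have dg := C_on_differentiable cg Ax.
exact: is_diff_derive (is_diffD (derive_is_diff df) (derive_is_diff dg)).
Qed.

Lemma C_on_scale W k (f : V -> R) (g : V -> W) :
  C_on k A f -> C_on k A g -> C_on k A (fun x => f x *: g x).
Proof.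
elim: k f g => [|k ih] f g cf cg.
  split=> // x Ax.
  have df := C_on_differentiable cf Ax; have dg := C_on_differentiable cg Ax.
  exact: is_diff_differentiable
    (is_diff_scale (derive_is_diff df) (derive_is_diff dg)).
have fg x : A x -> _ := fun Ax => is_diff_scale
  (derive_is_diff (C_on_differentiable cf Ax))
  (derive_is_diff (C_on_differentiable cg Ax)).
split=> [x Ax|v]; first exact: is_diff_differentiable (fg _ Ax).
apply: C_on_ext (C_onD (ih _ _ (C_onS cf) (cg.2 v)) (ih _ _ (cf.2 v) (C_onS cg))).
by move=> x Ax; rewrite (is_diff_derive _ (fg _ Ax)).
Qed.

Lemma C_on_sum W k n (f : 'I_n -> V -> W) :
  (forall l, C_on k A (f l)) -> C_on k A (fun x => \sum_(l < n) f l x).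
Proof.
move=> cf; elim: n f cf => [|n ih] f cf.
  by apply: C_on_ext (@C_on_cst W k 0) => x _; rewrite big_ord0.
have := C_onD (ih (fun l => f (widen_ord (leqnSn n) l)) (fun l => cf _))
  (cf ord_max).
by apply: C_on_ext => x _; rewrite big_ord_recr.
Qed.

Lemma C_on_linear_comp W n k (L : 'rV[R]_n -> W) (f : V -> 'rV[R]_n) :
  linear L -> C_on k A f -> C_on k A (L \o f).
Proof.
move=> Ll; elim: k f => [|k ih] f cf.
  split=> // x Ax; apply: is_diff_differentiable.
  exact: is_diff_linear_comp Ll (derive_is_diff (C_on_differentiable cf Ax)).
have df x (Ax : A x) :=
  is_diff_linear_comp Ll (derive_is_diff (C_on_differentiable cf Ax)).
split=> [x Ax|u]; first exact: is_diff_differentiable (df _ Ax).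
apply: C_on_ext (ih _ (cf.2 u)) => x Ax.
by rewrite (is_diff_derive _ (df _ Ax)).
Qed.

Lemma C_on_comp W n k (B : set 'rV[R]_n) (f : V -> 'rV[R]_n)
    (g : 'rV[R]_n -> W) :
  (forall x, A x -> B (f x)) -> C_on k A f -> C_on k B g -> C_on k A (g \o f).
Proof.
move=> AB; elim: k f g AB => [|k ih] f g AB cf cg.
  split=> // x Ax; apply: differentiable_comp.
    exact: C_on_differentiable cf Ax.
  exact: C_on_differentiable cg (AB _ Ax).
have fg x (Ax : A x) :=
  is_diff_comp (derive_is_diff (C_on_differentiable cf Ax))
    (derive_is_diff (C_on_differentiable cg (AB _ Ax))).
split=> [x Ax|v]; first exact: is_diff_differentiable (fg _ Ax).
(* The direction ['D_v f x] moves with [x], while [C_on] controls derivatives along fixed vectors;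
   expanding in the standard basis turns the chain rule into a sum of products. *)
have cD l : C_on k A (fun x => ('D_v f x) 0 l *: 'D_('e_l) g (f x)).
  apply: C_on_scale; last exact: (ih _ _ AB (C_onS cf) (cg.2 _)).
  exact: C_on_linear_comp (@coord_linear R n l) (cf.2 v).
apply: C_on_ext (C_on_sum cD) => x Ax.
rewrite (is_diff_derive _ (fg _ Ax)) /=.
rewrite [RHS](linear_coord_sum _ (derive_linear _)) //.
exact: C_on_differentiable cg (AB _ Ax).
Qed.

Lemma smooth_on_ext W (f g : V -> W) :
  (forall x, A x -> f x = g x) -> smooth_on A f -> smooth_on A g.
Proof.
by move=> fg /smooth_onP sf; apply/smooth_onP => k; exact: C_on_ext (sf k).
Qed.

Lemma smooth_on_cst W (c : W) : smooth_on A (cst c).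
Proof. by apply/smooth_onP => k; exact: C_on_cst. Qed.

Lemma smooth_onD W (f g : V -> W) :
  smooth_on A f -> smooth_on A g -> smooth_on A (fun x => f x + g x).
Proof.
by move=> /smooth_onP sf /smooth_onP sg; apply/smooth_onP => k; exact: C_onD.
Qed.

Lemma smooth_on_scale W (f : V -> R) (g : V -> W) :
  smooth_on A f -> smooth_on A g -> smooth_on A (fun x => f x *: g x).
Proof.
by move=> /smooth_onP sf /smooth_onP sg; apply/smooth_onP => k;
  exact: C_on_scale.
Qed.

Lemma smooth_on_sum W n (f : 'I_n -> V -> W) :
  (forall l, smooth_on A (f l)) -> smooth_on A (fun x => \sum_(l < n) f l x).
Proof.
by move=> sf; apply/smooth_onP => k; apply: C_on_sum => l;
  move: k; apply/smooth_onP.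
Qed.

Lemma smooth_on_linear_comp W n (L : 'rV[R]_n -> W) (f : V -> 'rV[R]_n) :
  linear L -> smooth_on A f -> smooth_on A (L \o f).
Proof.
by move=> Ll /smooth_onP sf; apply/smooth_onP => k; exact: C_on_linear_comp.
Qed.

Lemma smooth_on_comp W n (B : set 'rV[R]_n) (f : V -> 'rV[R]_n)
    (g : 'rV[R]_n -> W) :
  (forall x, A x -> B (f x)) -> smooth_on A f -> smooth_on B g ->
  smooth_on A (g \o f).
Proof.
by move=> AB /smooth_onP sf /smooth_onP sg; apply/smooth_onP => k;
  exact: C_on_comp AB _ _.
Qed.

End open_domain.

Lemma linear_smooth_on W n (A : set 'rV[R]_n) (f : 'rV[R]_n -> W) :
  open A -> linear f -> smooth_on A f.
Proof.
move=> oA fl; apply/smooth_onP => k.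
have df x := rV_linear_is_diff x fl.
have d0 x : A x -> differentiable f x.
  by move=> _; exact: is_diff_differentiable (df x).
case: k => [|k]; split=> // v.
by apply: C_on_ext (C_on_cst oA k (f v)) => // x _; rewrite (is_diff_derive _ (df x)).
Qed.

End smooth_calculus.

(** * Charts *)

(** The Jacobian of the transition from [i] to [j]. Both [tcoord] and [coord_field] are instances
    with [pref p] at one end, so changes of components reduce to [jac_comp]. *)
Definition jac (R : realType) (n : nat) (N : chart_space R n) (i j : Defs.index N)
  (p : N) (v : 'rV[R]_n) : 'rV[R]_n := 'D_v (chart j \o param i) (chart i p).

Section charts.
Context {R : realType} {n : nat} {N : chart_space R n}.
Hypothesis mN : smooth_manifold N.
Implicit Types (i j k : Defs.index N) (p q : N) (v w : 'rV[R]_n) (U : set N).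

Lemma jac_tcoord i p v : tcoord i p v = jac (pref p) i p v.
Proof. by []. Qed.

Lemma jac_coord_field i w p : coord_field i w p = jac i (pref p) p w.
Proof. by []. Qed.

Lemma chart_inj i p q : dom i p -> dom i q -> chart i p = chart i q -> p = q.
Proof.
move=> ip iq e.
by rewrite -(manifold_paramK mN ip) e (manifold_paramK mN iq).
Qed.

Lemma chart_setI i U U' :
  chart i @` (U `&` U' `&` dom i) =
  chart i @` (U `&` dom i) `&` chart i @` (U' `&` dom i).
Proof.
apply/seteqP; split => [x [p [[Up U'p] ip] <-]|x [[p [Up ip] <-] [q [U'q iq] e]]].
  by split; exists p.
by exists p => //; split=> //; split=> //; rewrite -(chart_inj iq ip e).
Qed.

Lemma atlas_openI U U' : atlas_open U -> atlas_open U' -> atlas_open (U `&` U').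
Proof. by move=> oU oU' i; rewrite chart_setI; exact: openI. Qed.

Lemma atlas_open_dom i : atlas_open (dom i).
Proof. by move=> j; rewrite setIC; exact: manifold_open. Qed.

Lemma near_chart i U p : atlas_open U -> U p -> dom i p ->
  \forall x \near chart i p, exists2 q, U q /\ dom i q & x = chart i q.
Proof.
move=> oU Up ip.
have := near_open (oU i) (x := chart i p) (ex_intro2 _ _ p (conj Up ip) erefl).
by apply: filterS => x [q Uq <-]; exists q.
Qed.

Lemma transition_differentiable i j p : dom i p -> dom j p ->
  differentiable (chart j \o param i) (chart i p).
Proof.
move=> ip jp; apply: (smooth_on_differentiable (@manifold_transition _ _ _ mN i j)).
by exists p.
Qed.

Lemma transition_is_diff i j p : dom i p -> dom j p ->
  is_diff (chart i p) (chart j \o param i) (jac i j p).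
Proof. by move=> ip jp; exact/derive_is_diff/transition_differentiable. Qed.

Lemma jac_linear i j p : dom i p -> dom j p -> linear (jac i j p).
Proof. by move=> ip jp; exact/derive_linear/transition_differentiable. Qed.

Lemma rep_change_near (T : Type) (F : N -> T) i j p : dom i p -> dom j p ->
  \forall x \near chart j p,
    (F \o param j) x = ((F \o param i) \o (chart i \o param j)) x.
Proof.
move=> ip jp; have := near_chart (@atlas_open_dom i) ip jp; apply: filterS.
move=> _ [q [iq jq] ->] /=.
by rewrite (manifold_paramK mN jq) (manifold_paramK mN iq).
Qed.

Lemma rep_change_is_diff (W : normedModType R) (F : N -> W) dF i j p :
  dom i p -> dom j p -> is_diff (chart i p) (F \o param i) dF ->
  is_diff (chart j p) (F \o param j) (dF \o jac j i p).
Proof.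
move=> ip jp dFi.
apply: near_is_diff; first by near do apply/esym; exact: rep_change_near ip jp.
apply: is_diff_comp (transition_is_diff jp ip) _ => /=.
by rewrite (manifold_paramK mN jp).
Unshelve. all: by end_near. Qed.

Lemma jac_comp i j k p v : dom i p -> dom j p -> dom k p ->
  jac j k p (jac i j p v) = jac i k p v.
Proof.
move=> ip jp kp; symmetry.
exact: is_diff_derive (rep_change_is_diff jp ip (transition_is_diff jp kp)).
Qed.

Lemma jac_id i p v : dom i p -> jac i i p v = v.
Proof.
move=> ip; rewrite /jac.
have : is_diff (chart i p) id id by exact: is_diff_id.
move=> h; have := near_is_diff _ h => /(_ (chart i \o param i)) hh.
apply: (is_diff_derive v (hh _)).
have := near_chart (@atlas_open_dom i) ip ip; apply: filterS => _ [q [_ iq] ->] /=.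
by rewrite (manifold_paramK mN iq).
Qed.

Lemma prefP p : dom (pref p) p.
Proof. exact: manifold_pref. Qed.
Hint Resolve prefP : core.

Lemma tcoord_linear i p : dom i p -> linear (tcoord i p).
Proof. by move=> ip; exact: jac_linear. Qed.

Lemma tcoord_pref p v : tcoord (pref p) p v = v.
Proof. by rewrite jac_tcoord jac_id. Qed.

Lemma jac_tcoordE i j p v : dom i p -> dom j p ->
  jac i j p (tcoord i p v) = tcoord j p v.
Proof. by move=> ip jp; rewrite !jac_tcoord jac_comp. Qed.

Lemma tcoord_coord_field i j w p : dom i p -> dom j p ->
  tcoord j p (coord_field i w p) = jac i j p w.
Proof. by move=> ip jp; rewrite jac_tcoord jac_coord_field jac_comp. Qed.

Lemma coord_field_tcoord i p v : dom i p ->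
  coord_field i (tcoord i p v) p = v.
Proof. by move=> ip; rewrite jac_coord_field jac_tcoordE // tcoord_pref. Qed.

Lemma coord_field_linear i p : dom i p -> linear (fun w => coord_field i w p).
Proof. by move=> ip; exact: (jac_linear ip). Qed.

Lemma rep_change_smooth (W : normedModType R) (F : N -> W) i j U :
  atlas_open U -> smooth_on (chart i @` (U `&` dom i)) (F \o param i) ->
  smooth_on (chart j @` (U `&` dom i `&` dom j)) (F \o param j).
Proof.
move=> oU sF.
have oUi : open (chart j @` (U `&` dom i `&` dom j)).
  exact: (atlas_openI oU (@atlas_open_dom i)).
apply: (smooth_on_ext oUi (f := (F \o param i) \o (chart i \o param j))).
  move=> _ [q [[Uq iq] jq] <-] /=.
  by rewrite (manifold_paramK mN jq) (manifold_paramK mN iq).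
apply: (smooth_on_comp oUi _ _ sF).
  move=> _ [q [[Uq iq] jq] <-] /=; exists q => //.
  by rewrite (manifold_paramK mN jq).
apply: smooth_on_sub (@manifold_transition _ _ _ mN j i).
by move=> _ [q [[Uq iq] jq] <-]; exists q.
Qed.

(** Components in another chart [j] are those in [i] contracted with the columns of the Jacobian,
    hence sums of products of smooth functions. *)
Lemma smooth_field_chart i U (Y : vector_field N) :
  atlas_open U -> U `<=` dom i ->
  smooth_on (chart i @` U) (local_rep i Y) -> smooth_field U Y.
Proof.
move=> oU Ui sY j.
have oUj := oU j.
have UiE : U `&` dom i = U by apply/setIidPl.
have Y_E x : (chart j @` (U `&` dom j)) x ->
    \sum_(l < n) (local_rep i Y (chart i (param j x))) 0 l *:
      jac i j (param j x) 'e_l = local_rep j Y x.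
  move=> [q [Uq jq] <-]; rewrite (manifold_paramK mN jq) /local_rep.
  have iq := Ui _ Uq; rewrite (manifold_paramK mN iq) (manifold_paramK mN jq).
  by rewrite -(linear_coord_sum _ (jac_linear iq jq)) jac_tcoordE.
apply: (smooth_on_ext oUj Y_E); apply: (smooth_on_sum oUj) => l.
apply: (smooth_on_scale oUj).
  apply: (smooth_on_linear_comp oUj (@coord_linear R n l)
    (f := fun x => local_rep i Y (chart i (param j x)))).
  have := @rep_change_smooth _ (fun q => local_rep i Y (chart i q)) i j U oU.
  rewrite UiE; apply; apply: (smooth_on_ext _ _ sY); first by rewrite -UiE.
  by move=> _ [q Uq <-] /=; rewrite (manifold_paramK mN (Ui _ Uq)).
have := @rep_change_smooth _ (fun q => jac i j q 'e_l) i j (dom j)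
  (@atlas_open_dom j).
move=> h; apply: smooth_on_sub (h _) => [_ [q [Uq jq] <-]|].
  by exists q => //; split=> //; split=> //; exact: Ui.
(* Read in the chart [i], a column of the Jacobian is a directional derivative of the transition
   map. *)
apply: (smooth_on_ext (@atlas_open_dom j i) (f := 'D_('e_l) (chart j \o param i))).
- by move=> _ [q [jq iq] <-] /=; rewrite /jac (manifold_paramK mN iq).
- by rewrite setIC; exact: smooth_on_derive (@manifold_transition _ _ _ mN i j).
Qed.

Lemma coord_field_rep i w p : dom i p ->
  local_rep i (coord_field i w) (chart i p) = w.
Proof.
move=> ip; rewrite /local_rep (manifold_paramK mN ip).
by rewrite tcoord_coord_field // jac_id.
Qed.

Lemma coord_field_smooth i w : smooth_field (dom i) (coord_field i w).
Proof.
have oi : open (chart i @` (dom i)).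
  by rewrite -[dom i]setIid; exact: atlas_open_dom.
apply: (smooth_field_chart (i := i) (@atlas_open_dom i)) => //.
apply: (smooth_on_ext oi (f := cst w)); last exact: smooth_on_cst.
by move=> _ [q iq <-]; rewrite coord_field_rep.
Qed.

Lemma smooth_field_sub U U' (Y : vector_field N) :
  U `<=` U' -> smooth_field U' Y -> smooth_field U Y.
Proof.
move=> UU' sY i; apply: smooth_on_sub (sY i) => _ [q [Uq iq] <-].
by exists q => //; split=> //; exact: UU'.
Qed.

Lemma smooth_fieldD U (Y Y' : vector_field N) : atlas_open U ->
  smooth_field U Y -> smooth_field U Y' ->
  smooth_field U (fun q => Y q + Y' q).
Proof.
move=> oU sY sY' i; apply: (smooth_on_ext (oU i) _ (smooth_onD (oU i) (sY i) (sY' i))).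
move=> _ [q [Uq iq] <-]; rewrite /local_rep (manifold_paramK mN iq).
by rewrite (linear_onD (tcoord_linear iq)).
Qed.

Lemma smooth_field_scale U (f : N -> R) (Y : vector_field N) : atlas_open U ->
  smooth_function U f -> smooth_field U Y ->
  smooth_field U (fun q => f q *: Y q).
Proof.
move=> oU sf sY i; apply: (smooth_on_ext (oU i) _ (smooth_on_scale (oU i) (sf i) (sY i))).
move=> _ [q [Uq iq] <-]; rewrite /local_rep /= (manifold_paramK mN iq).
by rewrite (linear_onZ (tcoord_linear iq)).
Qed.

End charts.

(** * Connections in a chart *)

Section connection_in_charts.
Context {R : realType} {n : nat} {N : chart_space R n}.
Hypothesis mN : smooth_manifold N.
Context {nabla : covariant N}.
Hypothesis cN : Defs.connection nabla.
Implicit Types (i j k : Defs.index N) (p q : N) (v w : 'rV[R]_n) (U : set N).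

Lemma smooth_function_chart i U (f : N -> R) :
  atlas_open U -> U `<=` dom i ->
  smooth_on (chart i @` U) (f \o param i) -> smooth_function U f.
Proof.
move=> oU Ui sf j.
have UiE : U `&` dom i = U by apply/setIidPl.
have := @rep_change_smooth _ _ _ mN _ f i j U oU.
by rewrite UiE; exact.
Qed.

Lemma smooth_field_ext U (Y Y' : vector_field N) : atlas_open U ->
  (forall q, U q -> Y q = Y' q) -> smooth_field U Y -> smooth_field U Y'.
Proof.
move=> oU YY' sY i; apply: (smooth_on_ext (oU i) _ (sY i)).
by move=> _ [q [Uq iq] <-]; rewrite /local_rep (manifold_paramK mN iq) YY'.
Qed.

Lemma smooth_field0 U : atlas_open U -> smooth_field U (fun=> 0).
Proof.
move=> oU i; apply: (smooth_on_ext (oU i) (f := cst 0)); last exact: smooth_on_cst.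
move=> _ [q [Uq iq] <-]; rewrite /local_rep (manifold_paramK mN iq).
by rewrite (linear_on0 (tcoord_linear mN iq)).
Qed.

(* With [f] vanishing exactly on [U], the field is [f] times itself, so the
   Leibniz rule alone gives the locality of [nabla]. *)
Lemma nabla_eq0 U (Y : vector_field N) p v : atlas_open U ->
  (forall q, U q -> Y q = 0) -> U p -> nabla Y p v = 0.
Proof.
move=> oU Y0 Up.
pose f q : R := if `[< U q >] then 0 else 1.
have fY : Y = (fun q => f q *: Y q).
  apply/funext => q; rewrite /f; case: asboolP => [Uq|_]; last by rewrite scale1r.
  by rewrite Y0 // scaler0.
have sf : smooth_function U f.
  move=> i; apply: (smooth_on_ext (oU i) (f := cst 0)); last exact: smooth_on_cst.
  move=> _ [q [Uq iq] <-] /=; rewrite (manifold_paramK mN iq) /f.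
  by rewrite asboolT.
have sY : smooth_field U Y.
  by apply: smooth_field_ext oU _ (smooth_field0 oU) => q /Y0.
have := connection_leibniz cN oU sf sY Up v.
by rewrite -fY Y0 // scaler0 add0r /f asboolT // scale0r.
Qed.

(** [Y'] is [Y] plus a field vanishing on [U], so additivity and [nabla_eq0] apply. *)
Lemma nabla_local U (Y Y' : vector_field N) p v : atlas_open U ->
  smooth_field U Y -> (forall q, U q -> Y q = Y' q) -> U p ->
  nabla Y p v = nabla Y' p v.
Proof.
move=> oU sY YY' Up.
have D0 q : U q -> Y' q - Y q = 0 by move=> /YY' ->; rewrite subrr.
have sD : smooth_field U (fun q => Y' q - Y q).
  by apply: smooth_field_ext oU _ (smooth_field0 oU) => q /D0.
have := connection_add cN oU sY sD Up v.
rewrite (nabla_eq0 v oU D0 Up) addr0 => <-.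
by congr (nabla _ p v); apply/funext => q; rewrite addrC subrK.
Qed.

Lemma smooth_field_sum U m (F : 'I_m -> vector_field N) : atlas_open U ->
  (forall l, smooth_field U (F l)) ->
  smooth_field U (fun q => \sum_(l < m) F l q).
Proof.
move=> oU; elim: m F => [|m ih] F sF.
  by apply: smooth_field_ext oU _ (smooth_field0 oU) => q _; rewrite big_ord0.
have sF' := ih (fun l => F (widen_ord (leqnSn m) l)) (fun l => sF _).
apply: smooth_field_ext oU _ (smooth_fieldD mN oU sF' (sF ord_max)).
by move=> q _; rewrite big_ord_recr.
Qed.

Lemma nabla_sum U m (F : 'I_m -> vector_field N) p v : atlas_open U -> U p ->
  (forall l, smooth_field U (F l)) ->
  nabla (fun q => \sum_(l < m) F l q) p v = \sum_(l < m) nabla (F l) p v.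
Proof.
move=> oU Up; elim: m F => [|m ih] F sF.
  by rewrite big_ord0 (nabla_eq0 v oU) // => q _; rewrite big_ord0.
pose F' l := F (widen_ord (leqnSn m) l).
have sF' l : smooth_field U (F' l) by exact: sF.
rewrite big_ord_recr /= -(ih F' sF').
rewrite -(connection_add cN oU (smooth_field_sum oU sF') (sF ord_max) Up).
by congr (nabla _ p v); apply/funext => q; rewrite big_ord_recr.
Qed.

(* Expanding in the standard basis makes this bilinear in [v] and [w] for every
   [p], even outside [dom i]. *)
Definition christoffel_in (i : Defs.index N) (p : N) (v w : 'rV[R]_n) :
    'rV[R]_n :=
  \sum_(l < n) w 0 l *: (\sum_(k < n) v 0 k *:
    tcoord i p (nabla (coord_field i 'e_l) p (coord_field i 'e_k p))).

Lemma christoffel_in_linearl i p w : linear (fun v => christoffel_in i p v w).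
Proof.
move=> a u v; rewrite /christoffel_in [X in _ = X + _]scaler_sumr -big_split.
apply: eq_bigr => l _ /=.
rewrite scalerA [a * _]mulrC -scalerA -scalerDr; congr (_ *: _).
rewrite [X in _ = X + _]scaler_sumr -big_split; apply: eq_bigr => k _ /=.
by rewrite !mxE scalerDl scalerA.
Qed.

Lemma christoffel_in_linearr i p v : linear (christoffel_in i p v).
Proof.
move=> a u w; rewrite /christoffel_in [X in _ = X + _]scaler_sumr -big_split.
by apply: eq_bigr => l _ /=; rewrite !mxE scalerDl scalerA.
Qed.

(** By locality [Y] may be replaced by its expansion in the coordinate fields of [i]; the Leibniz
    rule separates derivatives of the coefficients from Christoffel terms. The chart is arbitrary
    because nearby points and changes of chart involve charts other than [pref p]. *)
Lemma nabla_in_chart i U (Y : vector_field N) p v :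
  atlas_open U -> smooth_field U Y -> U p -> dom i p ->
  tcoord i p (nabla Y p v) =
    'D_(tcoord i p v) (local_rep i Y) (chart i p)
    + christoffel_in i p (tcoord i p v) (tcoord i p (Y p)).
Proof.
move=> oU sY Up ip.
pose f l q : R := tcoord i q (Y q) 0 l.
pose e l : vector_field N := coord_field i 'e_l.
have oUi := atlas_openI mN oU (@atlas_open_dom _ _ _ mN i).
have sYi : smooth_field (U `&` dom i) Y by apply: smooth_field_sub sY => q [].
have se l : smooth_field (U `&` dom i) (e l).
  by apply: smooth_field_sub (@coord_field_smooth _ _ _ mN i 'e_l) => q [].
have sf l : smooth_function (U `&` dom i) (f l).
  apply: (smooth_function_chart (i := i)) => //.
  exact: (smooth_on_linear_comp (oU i) (@coord_linear R n l) (sY i)).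
have sfe l := smooth_field_scale mN oUi (sf l) (se l).
have YE q : (U `&` dom i) q -> Y q = \sum_(l < n) f l q *: e l q.
  move=> [_ iq].
  by rewrite -(linear_coord_sum _ (coord_field_linear mN iq)) coord_field_tcoord.
have Upi : (U `&` dom i) p by [].
rewrite (nabla_local v oUi sYi YE Upi) (nabla_sum v oUi Upi sfe).
rewrite (linear_on_sum (tcoord_linear mN ip)).
have dY : is_diff (chart i p) (local_rep i Y)
    (fun u => 'D_u (local_rep i Y) (chart i p)).
  apply/derive_is_diff/(smooth_on_differentiable (sY i)).
  by exists p.
have jp := prefP mN p.
(* [dfun] is computed in [pref p]; passing to [i] turns the direction [v] into [tcoord i p v]. *)
have dfE l : dfun (f l) p v = ('D_(tcoord i p v) (local_rep i Y) (chart i p)) 0 l.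
  have := rep_change_is_diff (F := f l) mN ip jp (is_diff_coord l dY).
  exact: is_diff_derive.
transitivity (\sum_(l < n)
   (('D_(tcoord i p v) (local_rep i Y) (chart i p)) 0 l *: 'e_l
   + tcoord i p (Y p) 0 l *: tcoord i p (nabla (e l) p v))).
  apply: eq_bigr => l _; have tl := tcoord_linear mN ip.
  rewrite (connection_leibniz cN oUi (sf l) (se l) Upi) dfE.
  rewrite (linear_onD tl) !(linear_onZ tl); congr (_ *: _ + _).
  by rewrite tcoord_coord_field // jac_id.
rewrite big_split /= -row_sum_delta; congr (_ + _).
apply: eq_bigr => l _; congr (_ *: _).
have nl : linear (fun u => tcoord i p (nabla (e l) p (coord_field i u p))).
  move=> a u w; rewrite (coord_field_linear mN ip).
  rewrite (connection_linear cN oUi (se l) Upi) (tcoord_linear mN ip).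
  by [].
by rewrite -(linear_coord_sum _ nl) coord_field_tcoord.
Qed.

Lemma cov_coord_field_smooth i v w : smooth_on (chart i @` (dom i))
  (local_rep i (cov nabla (coord_field i v) (coord_field i w))).
Proof.
have := connection_smooth cN (@atlas_open_dom _ _ _ mN i)
  (@coord_field_smooth _ _ _ mN i v) (@coord_field_smooth _ _ _ mN i w).
by move=> /(_ i); rewrite setIid.
Qed.

Lemma christoffel_in_smooth i v w :
  smooth_on (chart i @` (dom i)) (fun x => christoffel_in i (param i x) v w).
Proof.
have oi : open (chart i @` (dom i)).
  by rewrite -[dom i]setIid; exact: atlas_open_dom.
apply: (smooth_on_sum oi) => l.
apply: (smooth_on_scale oi); first exact: (smooth_on_cst oi).
apply: (smooth_on_sum oi) => k.
apply: (smooth_on_scale oi); first exact: (smooth_on_cst oi).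
exact: cov_coord_field_smooth.
Qed.

End connection_in_charts.

(** * The bracket of a horizontal lift in R^n + R^n *)

Section bracket.
Context {R : realType}.

(** Expanding [a z] in the standard basis reduces this to the product rule, so differentiability of
    each [L^~ c] replaces joint differentiability; linearity near [z0] makes the expansion valid. *)
Lemma is_diff_param_linear (V W : normedModType R) n (L : V -> 'rV[R]_n -> W)
    (a da : V -> 'rV[R]_n) (z0 : V) :
  (\forall z \near z0, linear (L z)) ->
  (forall c, differentiable (L^~ c) z0) -> is_diff z0 a da ->
  is_diff z0 (fun z => L z (a z))
    (fun v => 'D_v (L^~ (a z0)) z0 + L z0 (da v)).
Proof.
move=> nL dL ha.
have E (b : V -> 'rV[R]_n) : \forall z \near z0,
    \sum_(k < n) (b z) 0 k *: L z 'e_k = L z (b z).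
  by apply: filterS nL => z Lz; rewrite -linear_coord_sum.
have L0 := nbhs_singleton nL.
have h (b db : V -> 'rV[R]_n) : is_diff z0 b db -> is_diff z0 (fun z => L z (b z))
    (fun v => \sum_(k < n) (b z0 0 k *: 'D_v (L^~ 'e_k) z0 + db v 0 k *: L z0 'e_k)).
  move=> hb; apply: near_is_diff (E b) _.
  apply: is_diff_sum => k; apply: is_diff_scale; first exact: is_diff_coord.
  exact: derive_is_diff.
apply: is_diff_eq (h _ _ ha) _; apply/funext => v.
rewrite big_split /= -(linear_coord_sum _ L0); congr (_ + _).
(* The same formula for the constant map [cst (a z0)] identifies the first sum. *)
rewrite (is_diff_derive v (h (cst (a z0)) 0 (is_diff_cst _ _))).
by apply: eq_bigr => k _; rewrite mxE scale0r addr0.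
Qed.

Context {n : nat} {G : 'rV[R]_n -> 'rV[R]_n -> 'rV[R]_n -> 'rV[R]_n}.
Hypothesis Gl : forall x b, linear (fun a => G x a b).
Hypothesis Gr : forall x a, linear (G x a).
Context {x0 w0 : 'rV[R]_n}.
Hypothesis dG : forall a b, differentiable (fun x => G x a b) x0.

Lemma is_diff_bilinear (V : normedModType R) (g dg a da b db : V -> 'rV[R]_n)
    (z0 : V) : g z0 = x0 ->
  is_diff z0 g dg -> is_diff z0 a da -> is_diff z0 b db ->
  is_diff z0 (fun z => G (g z) (a z) (b z))
    (fun v => 'D_(dg v) (fun x => G x (a z0) (b z0)) x0
      + G x0 (da v) (b z0) + G x0 (a z0) (db v)).
Proof.
move=> gz0 hg ha hb.
have h1 c d : is_diff z0 (fun z => G (g z) c d)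
    (fun v => 'D_(dg v) (fun x => G x c d) x0).
  apply: (is_diff_comp (g := fun x => G x c d) hg).
  by rewrite gz0; exact: derive_is_diff.
have h2 c : is_diff z0 (fun z => G (g z) c (b z))
      (fun v => 'D_v (fun z => G (g z) c (b z0)) z0 + G (g z0) c (db v)).
  apply: (is_diff_param_linear (L := fun z d => G (g z) c d) _ _ hb).
    by near=> z; exact: Gr.
  by move=> d; exact: is_diff_differentiable (h1 c d).
apply: is_diff_eq.
  apply: (is_diff_param_linear (L := fun z c => G (g z) c (b z)) _ _ ha).
    by near=> z; exact: Gl.
  by move=> c; exact: is_diff_differentiable (h2 c).
apply/funext => v; rewrite (is_diff_derive _ (h2 _)) (is_diff_derive _ (h1 _ _)).
by rewrite gz0 addrAC.
Unshelve. all: by end_near. Qed.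

Let z0 : 'rV[R]_(n + n) := row_mx x0 w0.

(** Components of X^h + V^v in an induced chart of TN, with [a] and [c] those of X and V; [rsubmx z]
    is the fibre coordinate. *)
Definition lift_rep (a c : 'rV[R]_(n + n) -> 'rV[R]_n) (z : 'rV[R]_(n + n)) :
    'rV[R]_(n + n) :=
  row_mx (a z) (c z - G (lsubmx z) (a z) (rsubmx z)).

Lemma lift_rep_is_diff a da c dc : is_diff z0 a da -> is_diff z0 c dc ->
  is_diff z0 (lift_rep a c) (fun v => row_mx (da v)
    (dc v - ('D_(lsubmx v) (fun x => G x (a z0) w0) x0 + G x0 (da v) w0
             + G x0 (a z0) (rsubmx v)))).
Proof.
move=> ha hc; apply: is_diff_row_mx => //; apply: is_diffB => //.
have hl : is_diff z0 lsubmx lsubmx by exact/rV_linear_is_diff/lsubmx_linear.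
have hr : is_diff z0 rsubmx rsubmx by exact/rV_linear_is_diff/rsubmx_linear.
have := is_diff_bilinear (row_mxKl _ _) hl ha hr.
by rewrite row_mxKr.
Qed.

Variables (Z : 'rV[R]_n -> 'rV[R]_n) (s : R).
Hypothesis dZ : differentiable Z x0.
Let Zh : 'rV[R]_(n + n) := row_mx (Z x0) (- G x0 (Z x0) w0).

(** The assumed equation says that the curvature R(Z, a) kills [w0]. In the lower block of the
    bracket, the derivatives of [G] and its quadratic terms add up to the difference of its two
    sides; what remains is again a lift, of [A] and [C]. *)
Lemma bracket_lift_rep a c :
  differentiable a z0 -> differentiable c z0 ->
  'D_(Z x0) (fun x => G x (a z0) w0) x0 + G x0 (Z x0) (G x0 (a z0) w0) =
  'D_(a z0) (fun x => G x (Z x0) w0) x0 + G x0 (a z0) (G x0 (Z x0) w0) ->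
  'D_(s *: Zh) (lift_rep a c) z0
  - 'D_(lift_rep a c z0) (fun z => s *: lift_rep (Z \o lsubmx) (cst 0) z) z0 =
  s *: (let A := 'D_Zh a z0 - 'D_(a z0) Z x0 in
        let C := 'D_Zh c z0 + G x0 (Z x0) (c z0) in
        row_mx A (C - G x0 A w0)).
Proof.
move=> da dc flat_eq.
have hl : is_diff z0 lsubmx lsubmx by exact/rV_linear_is_diff/lsubmx_linear.
have hZ : is_diff z0 (Z \o lsubmx) ((fun u => 'D_u Z x0) \o lsubmx).
  by apply: is_diff_comp; rewrite row_mxKl; exact: derive_is_diff.
have h0 : is_diff z0 (cst 0 : _ -> 'rV[R]_n) (fun=> 0) by exact: is_diff_cst.
have hV := is_diffZ s (lift_rep_is_diff hZ h0).
have hY := lift_rep_is_diff (derive_is_diff da) (derive_is_diff dc).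
rewrite (is_diff_derive _ hV) (linear_onZ (derive_linear _)); last first.
  exact: is_diff_differentiable hY.
rewrite (is_diff_derive _ hY) fctE /= -[X in _ - X]/(_ *: _) -scalerBr.
congr (_ *: _).
rewrite /lift_rep /Zh /= /z0 !(row_mxKl, row_mxKr) /= -/z0 -/Zh.
rewrite opp_row_mx add_row_mx; congr row_mx.
rewrite !(linear_onB (Gl _ _)) !(linear_onB (Gr _ _)) !(linear_onN (Gr _ _)).
by apply/rowP => k; move/rowP/(_ k): flat_eq; rewrite !mxE; lra.
Qed.

End bracket.

(** * Conical special complex manifolds in a chart *)

Local Opaque derive.

Lemma subr_congr (V : zmodType) (a b a' b' : V) :
  a = a' -> b = b' -> a - b = a' - b'.
Proof. by move=> -> ->. Qed.

Section mul_i.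
Context {R : realType} {m : nat}.

Lemma mul_i_linear : linear (@mul_i R m).
Proof.
by move=> a u v; rewrite /mul_i !linearP /= scale_row_mx add_row_mx.
Qed.

End mul_i.

Section conical.
Context {R : realType} {m : nat} {N : chart_space R (m + m)}.
Context {J : endo_field N} {nabla : covariant N} {xi : vector_field N}.
Hypothesis hN : conical_special_complex_manifold J nabla xi.
Notation n := (m + m)%N.

Let sN : special_complex_manifold J nabla := conical_special hN.
Let mN : smooth_manifold N := complex_manifold_smooth (special_complex sN).
Let cN : Defs.connection nabla := special_connection sN.

Lemma tcoord_J i p v : dom i p -> tcoord i p (J p v) = mul_i (tcoord i p v).
Proof. exact: (complex_manifold_J (special_complex sN)). Qed.

Lemma J_mul_i p v : J p v = mul_i v.
Proof.
have ip := prefP mN p.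
by rewrite -[LHS](tcoord_pref mN p) tcoord_J // tcoord_pref.
Qed.

Lemma local_rep_J i (Y : vector_field N) q : dom i q ->
  local_rep i (app_field J Y) (chart i q) = mul_i (local_rep i Y (chart i q)).
Proof.
by move=> iq; rewrite /local_rep /app_field (manifold_paramK mN iq) tcoord_J.
Qed.

Lemma smooth_field_J U (Y : vector_field N) : atlas_open U ->
  smooth_field U Y -> smooth_field U (app_field J Y).
Proof.
move=> oU sY i; apply: (smooth_on_ext (oU i) _
  (smooth_on_linear_comp (oU i) mul_i_linear (sY i))).
by move=> _ [q [Uq iq] <-]; rewrite local_rep_J.
Qed.

Lemma atlas_openT : atlas_open [set: N].
Proof.
move=> i; rewrite setTI -[dom i]setIid; exact: (manifold_open mN).
Qed.

(** * Christoffel symbols, J and xi at one point, in its preferred chart *)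

Section at_point.
Variable p : N.
Let i := pref p.
Let ip : dom i p := prefP mN p.
Let oi : atlas_open (dom i) := @atlas_open_dom _ _ _ mN i.
Let c := christoffel_in (nabla := nabla) i p.
Let x0 := chart i p.

Lemma nabla_in_pref_chart U (Y : vector_field N) v :
  atlas_open U -> smooth_field U Y -> U p ->
  nabla Y p v = 'D_v (local_rep i Y) x0 + c v (Y p).
Proof.
move=> oU sY Up; rewrite -[LHS](tcoord_pref mN p).
by rewrite (nabla_in_chart mN cN v oU sY Up ip) !tcoord_pref.
Qed.

Lemma near_dom (P : 'rV[R]_n -> Prop) :
  (forall q, dom i q -> P (chart i q)) -> \forall x \near x0, P x.
Proof.
move=> h; have := near_chart oi ip ip.
by apply: filterS => _ [q [_ iq] ->]; exact: h.
Qed.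

Lemma derive_coord_field v w : 'D_v (local_rep i (coord_field i w)) x0 = 0.
Proof.
rewrite -(derive_cst w x0 v); apply: near_eq_derive; apply: near_dom => q iq.
by rewrite coord_field_rep.
Qed.

Lemma coord_field_pref w : coord_field i w p = w.
Proof. by rewrite -[RHS](coord_field_tcoord mN _ ip) tcoord_pref. Qed.

Let se w : smooth_field (dom i) (coord_field i w) :=
  @coord_field_smooth _ _ _ mN i w.

Lemma nabla_coord_field v w : nabla (coord_field i w) p v = c v w.
Proof.
by rewrite (nabla_in_pref_chart _ oi (se w) ip) derive_coord_field add0r coord_field_pref.
Qed.

Lemma local_rep_differentiable U (Y : vector_field N) :
  atlas_open U -> smooth_field U Y -> U p ->
  differentiable (local_rep i Y) x0.
Proof.
move=> oU sY Up; apply: (smooth_on_differentiable (sY i)).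
by exists p.
Qed.

Lemma derive_local_rep_J U (Y : vector_field N) v :
  atlas_open U -> smooth_field U Y -> U p ->
  'D_v (local_rep i (app_field J Y)) x0 = mul_i ('D_v (local_rep i Y) x0).
Proof.
move=> oU sY Up; have dY := local_rep_differentiable oU sY Up.
have := is_diff_linear_comp mul_i_linear (derive_is_diff dY).
move=> /(is_diff_derive v) /= <-.
by apply: near_eq_derive; apply: near_dom => q iq; rewrite local_rep_J.
Qed.

Lemma lie_bracket_coord_field v w :
  lie_bracket (coord_field i v) (coord_field i w) p = 0.
Proof.
rewrite /lie_bracket -/i -/x0.
rewrite [X in X - _](derive_coord_field (coord_field i v p) w).
by rewrite [X in _ - X](derive_coord_field (coord_field i w p) v) subr0.
Qed.

Lemma christoffel_sym v w : c v w = c w v.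
Proof.
have := special_torsion_free sN oi (se v) (se w) ip.
rewrite lie_bracket_coord_field subr0 /cov !nabla_coord_field !coord_field_pref.
by move/eqP; rewrite subr_eq0 => /eqP.
Qed.

(** J has constant components, so (nabla_v J) w = Gamma(v, J w) - J Gamma(v, w). The last term is
    symmetric because torsion vanishes, so the symmetry of nabla J passes to Gamma(v, J w). *)
Lemma christoffel_J v w : c v (mul_i w) = c (mul_i v) w.
Proof.
have E a b : cov_endo nabla J (coord_field i a) (coord_field i b) p =
    c a (mul_i b) - mul_i (c a b).
  rewrite /cov_endo /cov J_mul_i nabla_coord_field coord_field_pref.
  rewrite (nabla_in_pref_chart _ oi (smooth_field_J oi (se b)) ip).
  rewrite (derive_local_rep_J _ oi (se b) ip) derive_coord_field.
  by rewrite (linear_on0 mul_i_linear) add0r /app_field J_mul_i coord_field_pref.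
have := special_symmetric sN oi (se v) (se w) ip.
rewrite !E (christoffel_sym w v) => /addIr ->.
exact: christoffel_sym.
Qed.

Lemma derive_xi v : 'D_v (local_rep i xi) x0 = v - c v (xi p).
Proof.
have := conical_nabla hN p v.
rewrite (nabla_in_pref_chart _ atlas_openT (conical_smooth hN)) // => e.
by rewrite -[X in X - _]e addrK.
Qed.

(** The Cauchy-Riemann equations for xi: when L_xi J = 0 is tested on a coordinate field, both
    brackets reduce to minus a derivative of xi. *)
Lemma derive_xi_mul_i v :
  'D_(mul_i v) (local_rep i xi) x0 = mul_i ('D_v (local_rep i xi) x0).
Proof.
have bJ : lie_bracket xi (app_field J (coord_field i v)) p =
    - 'D_(mul_i v) (local_rep i xi) x0.
  rewrite /lie_bracket -[RHS]sub0r; apply: subr_congr.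
    rewrite (derive_local_rep_J _ oi (se v) ip) derive_coord_field.
    exact: linear_on0 mul_i_linear.
  by rewrite /app_field J_mul_i coord_field_pref.
have b1 : lie_bracket xi (coord_field i v) p = - 'D_v (local_rep i xi) x0.
  rewrite /lie_bracket -[RHS]sub0r; apply: subr_congr.
    exact: derive_coord_field.
  by rewrite coord_field_pref.
have := conical_lie hN oi (se v) ip.
rewrite /lie_derivative bJ b1 J_mul_i (linear_onN mul_i_linear) opprK addrC.
by move/eqP; rewrite subr_eq0 => /eqP.
Qed.

Let Z : vector_field N := app_field J xi.

Lemma J_xi_smooth : smooth_field setT Z.
Proof. exact: smooth_field_J atlas_openT (conical_smooth hN). Qed.

(** Substitute D_v xi = v - Gamma(v, xi) in the Cauchy-Riemann equations; the terms J v cancel. *)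
Lemma christoffel_xi v : c (mul_i v) (xi p) = mul_i (c v (xi p)).
Proof.
have := derive_xi_mul_i v; rewrite !derive_xi (linear_onB mul_i_linear).
by move/addrI/oppr_inj.
Qed.

(** This is nabla_v Z = J v: in J (v - Gamma(v, xi)), the J before Gamma moves onto v and from there
    onto xi. *)
Lemma derive_J_xi v : 'D_v (local_rep i Z) x0 = mul_i v - c v (Z p).
Proof.
rewrite (derive_local_rep_J _ atlas_openT (conical_smooth hN)) // derive_xi.
rewrite (linear_onB mul_i_linear) -christoffel_xi -christoffel_J.
by rewrite /Z /app_field J_mul_i.
Qed.

(** This is L_Z J = 0, inherited from xi because J is constant in the chart. *)
Lemma derive_J_xi_mul_i v :
  'D_(mul_i v) (local_rep i Z) x0 = mul_i ('D_v (local_rep i Z) x0).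
Proof.
by rewrite !(derive_local_rep_J _ atlas_openT (conical_smooth hN)) // derive_xi_mul_i.
Qed.

(** This is nabla_Z J = 0. It holds because Gamma(Z, v) = J Gamma(v, xi) and Gamma(-, xi) commutes
    with J. *)
Lemma christoffel_J_xi v : c (Z p) (mul_i v) = mul_i (c (Z p) v).
Proof.
have E w : c (Z p) w = mul_i (c w (xi p)).
  rewrite christoffel_sym /Z /app_field J_mul_i christoffel_J.
  exact: christoffel_xi.
by rewrite !E christoffel_xi.
Qed.

Lemma christoffel_in_differentiable v w : differentiable
  (fun x => christoffel_in (nabla := nabla) i (param i x) v w) x0.
Proof.
apply: (smooth_on_differentiable (@christoffel_in_smooth _ _ _ mN _ cN i v w)).
by exists p.
Qed.

Lemma flat_christoffel a b w :
  'D_a (fun x => christoffel_in (nabla := nabla) i (param i x) b w) x0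
    + c a (c b w) =
  'D_b (fun x => christoffel_in (nabla := nabla) i (param i x) a w) x0
    + c b (c a w).
Proof.
have E u v : cov nabla (coord_field i u)
    (cov nabla (coord_field i v) (coord_field i w)) p =
   'D_u (fun x => christoffel_in (nabla := nabla) i (param i x) v w) x0 + c u (c v w).
  rewrite {1}/cov coord_field_pref.
  rewrite (nabla_in_pref_chart _ oi (connection_smooth cN oi (se v) (se w)) ip).
  rewrite {2}/cov nabla_coord_field coord_field_pref; congr (_ + _).
  (* The outer derivative sees the inner one at points [q] near [p], for which [i] need not be the
     preferred chart. *)
  apply: near_eq_derive; apply: near_dom => q iq.
  rewrite /local_rep (manifold_paramK mN iq) /cov.
  rewrite (nabla_in_chart mN cN _ oi (se w) iq iq) !tcoord_coord_field // !jac_id //.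
  have -> : 'D_v (local_rep i (coord_field i w)) (chart i q) = 0.
    rewrite -(derive_cst w (chart i q) v); apply: near_eq_derive.
    have := near_chart oi iq iq; apply: filterS => _ [q' [_ iq'] ->].
    by rewrite coord_field_rep.
  by rewrite add0r.
have := special_flat sN oi (se a) (se b) (se w) ip.
rewrite !E /cov lie_bracket_coord_field nabla_coord_field.
rewrite [c 0 w](linear_on0 (christoffel_in_linearl i p w)) subr0.
by move/eqP; rewrite subr_eq0 => /eqP.
Qed.

End at_point.

End conical.

(** * Charts of the tangent bundle *)

Section tangent_charts.
Context {R : realType} {n : nat} {N : chart_space R n}.
Hypothesis mN : smooth_manifold N.
Context {nabla : covariant N}.
Hypothesis cN : Defs.connection nabla.
Implicit Types (i j k : Defs.index N) (p q : N) (v w : 'rV[R]_n).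
Notation M := (tangent_bundle N).

Lemma near_lsubmx n1 n2 (z : 'rV[R]_(n1 + n2)) (P : 'rV[R]_n1 -> Prop) :
  (\forall x \near lsubmx z, P x) -> \forall y \near z, P (lsubmx y).
Proof. by move=> h; exact: (@continuous_lsubmx R 1 n1 n2 z _ h). Qed.

Lemma transition_near_is_diff k i q : dom k q -> dom i q ->
  \forall x \near chart k q, differentiable (chart i \o param k) x.
Proof.
move=> kq iq; have := near_chart (@atlas_open_dom _ _ _ mN i) iq kq.
apply: filterS => _ [q' [iq' kq'] ->].
exact: (transition_differentiable mN kq' iq').
Qed.

(** The charts of TN pass through [pref] of the moving base point; the chain rule cancels it and
    leaves a formula that can be differentiated. *)
Lemma tangent_transition_near k i q w : dom k q -> dom i q ->
  \forall z \near row_mx (chart k q) w,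
    row_mx ((chart i \o param k) (lsubmx z))
      ('D_(rsubmx z) (chart i \o param k) (lsubmx z)) =
    (chart (c := M) i \o param (c := M) k) z.
Proof.
move=> kq iq.
have := near_chart (@atlas_open_dom _ _ _ mN i) iq kq.
rewrite -{1}(row_mxKl (chart k q) w) => /near_lsubmx.
apply: filterS => z [q' [iq' kq'] e] /=.
rewrite e (manifold_paramK mN kq'); congr row_mx.
rewrite -/(jac k (pref q') q' (rsubmx z)) jac_tcoord (jac_comp mN) //.
exact: prefP.
Qed.

Lemma derive_transition_is_diff k i q w : dom k q -> dom i q ->
  is_diff (chart k q) ('D_w (chart i \o param k))
    (fun v => 'D_v ('D_w (chart i \o param k)) (chart k q)).
Proof.
move=> kq iq; apply/derive_is_diff.
apply: (smooth_on_differentiable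
  (smooth_on_derive w (@manifold_transition _ _ _ mN k i))).
by exists q.
Qed.

Lemma tangent_transition_is_diff k i q w : dom k q -> dom i q ->
  is_diff (row_mx (chart k q) w) (chart (c := M) i \o param (c := M) k)
    (fun A => row_mx (jac k i q (lsubmx A))
      ('D_(lsubmx A) ('D_w (chart i \o param k)) (chart k q)
       + jac k i q (rsubmx A))).
Proof.
move=> kq iq; set z0 := row_mx _ _.
apply: near_is_diff (tangent_transition_near w kq iq) _.
have hl : is_diff z0 lsubmx lsubmx by exact/rV_linear_is_diff/lsubmx_linear.
have hr : is_diff z0 rsubmx rsubmx by exact/rV_linear_is_diff/rsubmx_linear.
have hD v : is_diff z0 (fun z => 'D_v (chart i \o param k) (lsubmx z))
   (fun A => 'D_(lsubmx A) ('D_v (chart i \o param k)) (chart k q)).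
  apply: (is_diff_comp (g := 'D_v (chart i \o param k)) hl).
  by rewrite row_mxKl; exact: derive_transition_is_diff.
have h1 : is_diff z0 (fun z => (chart i \o param k) (lsubmx z))
    (fun A => jac k i q (lsubmx A)).
  apply: (is_diff_comp (g := chart i \o param k) hl).
  by rewrite row_mxKl; exact: transition_is_diff.
have h2 : is_diff z0 (fun z => 'D_(rsubmx z) (chart i \o param k) (lsubmx z))
    (fun A => 'D_(lsubmx A) ('D_w (chart i \o param k)) (chart k q)
       + jac k i q (rsubmx A)).
  have nL : \forall z \near z0,
      linear (fun v => 'D_v (chart i \o param k) (lsubmx z)).
    have := transition_near_is_diff kq iq.
    rewrite -{1}(row_mxKl (chart k q) w) => /near_lsubmx.
    by apply: filterS => z; exact: derive_linear.
  have hh := is_diff_param_linear nL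
    (fun v => is_diff_differentiable (hD v)) hr.
  apply: (is_diff_eq hh); apply/funext => A.
  by rewrite (is_diff_derive A (hD _)) /z0 row_mxKl row_mxKr.
exact: is_diff_row_mx h1 h2.
Qed.

Lemma tangent_tcoord_is_diff i q w : dom i q ->
  is_diff (chart (c := M) (pref q) (q, w))
    (chart (c := M) i \o param (c := M) (pref q))
    (fun A => row_mx (tcoord i q (lsubmx A))
      ('D_(lsubmx A) ('D_w (chart i \o param (pref q))) (chart (pref q) q)
       + tcoord i q (rsubmx A))).
Proof.
move=> iq.
have := tangent_transition_is_diff w (prefP mN q) iq.
by rewrite /= (tcoord_pref mN).
Qed.

Lemma tangent_tcoordE i (q : N) w A : dom i q ->
  tcoord (N := M) i (q, w) A = row_mx (tcoord i q (lsubmx A))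
      ('D_(lsubmx A) ('D_w (chart i \o param (pref q))) (chart (pref q) q)
       + tcoord i q (rsubmx A)).
Proof. by move=> iq; exact: is_diff_derive (tangent_tcoord_is_diff w iq). Qed.

Lemma tangent_tcoord_linear i (q : N) w : dom i q ->
  linear (tcoord (N := M) i (q, w)).
Proof.
move=> iq; apply: derive_linear.
exact: is_diff_differentiable (tangent_tcoord_is_diff w iq).
Qed.

(** The inhomogeneous transformation law of Christoffel symbols: the second derivative appears
    because coordinate fields of [pref q] have non-constant components in [i]. *)
Lemma tcoord_christoffel i q v w : dom i q ->
  tcoord i q (christoffel nabla q v w) =
  'D_v ('D_w (chart i \o param (pref q))) (chart (pref q) q)
  + christoffel_in (nabla := nabla) i q (tcoord i q v) (tcoord i q w).
Proof.
move=> iq; set k := pref q; have kq : dom k q := prefP mN q.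
rewrite /christoffel (nabla_in_chart mN cN v (@atlas_open_dom _ _ _ mN k)
  (@coord_field_smooth _ _ _ mN k w) kq iq).
have ew : tcoord i q (coord_field k w q) = tcoord i q w.
  exact: tcoord_coord_field.
rewrite ew; apply: (congr1 (+%R^~ _)).
have hk : is_diff (chart k q)
    ((fun q' => tcoord i q' (coord_field k w q')) \o param k)
    (fun v => 'D_v ('D_w (chart i \o param k)) (chart k q)).
  apply: near_is_diff _ (derive_transition_is_diff w kq iq).
  have := near_chart (@atlas_open_dom _ _ _ mN i) iq kq.
  apply: filterS => _ [q' [iq' kq'] ->] /=.
  by rewrite (manifold_paramK mN kq') (tcoord_coord_field mN).
have := is_diff_derive (tcoord i q v) (rep_change_is_diff mN kq iq hk).
move=> -> /=; have -> // : jac i k q (tcoord i q v) = v.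
by rewrite jac_tcoordE // tcoord_pref.
Qed.

(** The second derivative of the transition enters twice, from the chart change on TN and from the
    Christoffel symbols, and cancels: lifts defined through [pref] keep their form in every
    chart. *)
Lemma tcoord_lift i (u : M) v w : dom i u.1 ->
  tcoord (N := M) i u (hlift nabla u v + vlift u w) =
  row_mx (tcoord i u.1 v) (tcoord i u.1 w -
    christoffel_in (nabla := nabla) i u.1 (tcoord i u.1 v) (tcoord i u.1 u.2)).
Proof.
case: u => q b /= iq; rewrite tangent_tcoordE // /hlift /vlift add_row_mx.
rewrite addr0 row_mxKl row_mxKr /=; congr row_mx.
rewrite (linear_onD (tcoord_linear mN iq)) (linear_onN (tcoord_linear mN iq)).
by rewrite tcoord_christoffel // opprD !addrA subrr add0r addrC.
Qed.

Lemma vlift_linear (u : M) : linear (vlift u).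
Proof.
by move=> a v w; rewrite /vlift scale_row_mx add_row_mx scaler0 addr0.
Qed.

Lemma hlift_linear (u : M) : linear (hlift nabla u).
Proof.
move=> a v w; rewrite /hlift scale_row_mx add_row_mx /christoffel.
have pu := prefP mN u.1.
rewrite (connection_linear cN (@atlas_open_dom _ _ _ mN _)
  (@coord_field_smooth _ _ _ mN _ _) pu) //.
by rewrite opprD scalerN.
Qed.

(* [X u] is seen as a vector of [N] at the base point [u.1]. *)
Definition base_rep (i : Defs.index N) (X : M -> 'rV[R]_n)
    (z : 'rV[R]_(n + n)) : 'rV[R]_n :=
  tcoord i (param (c := M) i z).1 (X (param (c := M) i z)).

Lemma local_rep_lift i (X V : M -> 'rV[R]_n) (z : 'rV[R]_(n + n)) :
  (chart i @` (dom i)) (lsubmx z) ->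
  local_rep (N := M) i (fun u => hlift nabla u (X u) + vlift u (V u)) z =
  lift_rep (G := fun x => christoffel_in (nabla := nabla) i (param i x))
    (base_rep i X) (base_rep i V) z.
Proof.
move=> [q iq e].
have pz : param (c := M) i z = (q, coord_field i (rsubmx z) q).
  by rewrite /= -e (manifold_paramK mN iq).
have re : tcoord i q (coord_field i (rsubmx z) q) = rsubmx z.
  by rewrite (tcoord_coord_field mN) // (jac_id mN).
have pl : param i (lsubmx z) = q by rewrite -e (manifold_paramK mN iq).
rewrite /local_rep /base_rep /lift_rep.
rewrite pz.
rewrite pl.
rewrite (tcoord_lift (u := (q, _) : M)) //.
rewrite [X in christoffel_in _ _ _ X]re.
by [].
Qed.

Lemma tangent_paramK i (u : M) : dom i u.1 ->
  param (c := M) i (chart (c := M) i u) = u.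
Proof.
case: u => q w /= iq; rewrite row_mxKl row_mxKr (manifold_paramK mN iq).
apply: (congr1 (pair q)); exact: (coord_field_tcoord mN w iq).
Qed.

Lemma tangent_chart_pref (q : N) w :
  chart (c := M) (pref q) (q, w) = row_mx (chart (pref q) q) w.
Proof. by rewrite /= (tcoord_pref mN). Qed.

Lemma tangent_chart_image i :
  chart (c := M) i @` (setT `&` dom (c := M) i) =
  lsubmx @^-1` (chart i @` (dom i)).
Proof.
apply/seteqP; split => [_ [u [_ iu] <-]|z [q iq e]] /=.
  by rewrite row_mxKl; exists u.1.
exists (q, coord_field i (rsubmx z) q) => //=.
by rewrite tcoord_coord_field // jac_id // e hsubmxK.
Qed.

Lemma open_tangent_chart_image i :
  open (chart (c := M) i @` (setT `&` dom (c := M) i)).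
Proof.
rewrite tangent_chart_image; apply: open_comp.
  by move=> z _; exact: continuous_lsubmx.
by rewrite -[dom i]setIid; exact: atlas_open_dom.
Qed.

Lemma lift_rep_smooth i (a b : 'rV[R]_(n + n) -> 'rV[R]_n) :
  let A := chart (c := M) i @` (setT `&` dom (c := M) i) in
  smooth_on A a -> smooth_on A b ->
  smooth_on A (lift_rep
    (G := fun x => christoffel_in (nabla := nabla) i (param i x)) a b).
Proof.
move=> A sa sb; have oA : open A := @open_tangent_chart_image i.
have sl : smooth_on A lsubmx by apply: linear_smooth_on oA _; exact: lsubmx_linear.
have sr : smooth_on A rsubmx by apply: linear_smooth_on oA _; exact: rsubmx_linear.
have sc (k : 'I_n) (f : 'rV[R]_(n + n) -> 'rV[R]_n) :
    smooth_on A f -> smooth_on A (fun z => f z 0 k : R).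
  by move=> sf; exact: (smooth_on_linear_comp oA (@coord_linear R n k) sf).
have l1 : linear (fun a : 'rV[R]_n => row_mx a (0 : 'rV[R]_n)).
  by move=> s u v; rewrite scale_row_mx add_row_mx scaler0 addr0.
have l2 : linear (fun a : 'rV[R]_n => row_mx (0 : 'rV[R]_n) a).
  by move=> s u v; rewrite scale_row_mx add_row_mx scaler0 addr0.
have lN : linear (fun a : 'rV[R]_n => - a).
  by move=> s u v; rewrite opprD scalerN.
(* [christoffel_in] unfolds to a double sum of products of components of [a], fibre coordinates and
   smooth functions of the base point. *)
have sG : smooth_on A (fun z => christoffel_in (nabla := nabla) i
    (param i (lsubmx z)) (a z) (rsubmx z)).
  apply: (smooth_on_sum oA) => k; apply: (smooth_on_scale oA); first exact: sc.
  apply: (smooth_on_sum oA) => l; apply: (smooth_on_scale oA); first exact: sc.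
  apply: (smooth_on_comp oA _ sl
    (@cov_coord_field_smooth _ _ _ mN _ cN i 'e_l 'e_k)).
  by move=> z; rewrite /A tangent_chart_image.
have := smooth_onD oA (smooth_on_linear_comp oA l1 sa)
  (smooth_on_linear_comp oA l2 (smooth_onD oA sb (smooth_on_linear_comp oA lN sG))).
apply: (smooth_on_ext oA) => z _ /=.
by rewrite add_row_mx addr0 add0r.
Qed.

End tangent_charts.

(** * The rotating vector field *)

(* [2 Z^h, I_2 Y] - I_2 [2 Z^h, Y], with [H] and [K] the horizontal and the
   vertical lift. *)
Lemma hyper2_algebra (R : pzRingType) (V W : lmodType R) (H K : V -> W)
    (s : R) (a b d e f g : V) : linear H -> linear K ->
  H (s *: (a - b)) + K (s *: (- d - e)) -
    (H (s *: (a + f)) - K (s *: (d - g))) =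
  - (s *: (H (b + f) + K (g + e))).
Proof.
move=> Hl Kl.
rewrite opprB [K _ - H _]addrC addrACA -(linear_onB Hl) -(linear_onD Kl).
rewrite -scalerBr -scalerDr opprD addrACA subrr add0r -opprD.
rewrite [X in K (_ *: X)]addrACA addNr add0r -opprD [e + g]addrC.
rewrite !scalerN (linear_onN Hl) (linear_onN Kl) (linear_onZ Hl) (linear_onZ Kl).
by rewrite -opprD scalerDr.
Qed.

Section rotating.
Context {R : realType} {m : nat} {N : chart_space R (m + m)}.
Context {J : endo_field N} {nabla : covariant N} {xi : vector_field N}.
Hypothesis hN : conical_special_complex_manifold J nabla xi.
Notation M := (tangent_bundle N).
Notation n := (m + m)%N.

Let sN : special_complex_manifold J nabla := conical_special hN.
Let mN : smooth_manifold N := complex_manifold_smooth (special_complex sN).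
Let cN : Defs.connection nabla := special_connection sN.
Let Z : vector_field N := app_field J xi.
Let G (i : Defs.index N) (x : 'rV[R]_n) :=
  christoffel_in (nabla := nabla) i (param i x).

Definition rotating_field : vector_field M :=
  fun u => 2 *: hlift_field nabla Z u.

Lemma local_rep_rotating i (z : 'rV[R]_(n + n)) :
  (chart i @` (dom i)) (lsubmx z) ->
  local_rep (N := M) i rotating_field z =
  2 *: lift_rep (G := G i) (local_rep i Z \o lsubmx) (cst 0) z.
Proof.
move=> Dz; have [q iq e] := Dz.
have pz : param i (lsubmx z) = q by rewrite -e (manifold_paramK mN iq).
have iz : dom i (param i (lsubmx z)) by rewrite pz.
rewrite -[RHS]/(2 *: lift_rep (G := G i) (base_rep i (fun u => Z u.1)) (cst 0) z).
have -> : lift_rep (G := G i) (base_rep i (fun u => Z u.1)) (cst 0) z =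
    lift_rep (G := G i) (base_rep i (fun u : M => Z u.1)) (base_rep i (fun u : M => 0)) z.
  rewrite /lift_rep {4}/base_rep.
  by rewrite (linear_on0 (tcoord_linear mN iz)).
rewrite -(local_rep_lift mN cN _ _ Dz) /local_rep /rotating_field.
rewrite (linear_onZ (tangent_tcoord_linear mN _ iz)) /hlift_field.
by rewrite (linear_on0 (vlift_linear _)) addr0.
Qed.

Lemma rotating_smooth : smooth_field setT rotating_field.
Proof.
suff h (i : Defs.index N) : smooth_on (chart (c := M) i @` (setT `&` dom (c := M) i))
    (local_rep (N := M) i rotating_field) by move=> i; exact: h.
have oA := open_tangent_chart_image mN (i := i).
have lZ : linear (fun v : 'rV[R]_(n + n) => 2 *: v).
  by move=> s u v; rewrite scalerDr !scalerA mulrC.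
have sl : smooth_on (chart (c := M) i @` (setT `&` dom (c := M) i)) lsubmx.
  by apply: linear_smooth_on oA _; exact: lsubmx_linear.
have sZ : smooth_on (chart (c := M) i @` (setT `&` dom (c := M) i))
    (local_rep i Z \o lsubmx).
  apply: (smooth_on_comp oA _ sl (J_xi_smooth hN (i := i))).
  by move=> z; rewrite (tangent_chart_image mN) setTI.
have s0 : smooth_on (chart (c := M) i @` (setT `&` dom (c := M) i))
    (cst 0 : _ -> 'rV[R]_n) by exact: smooth_on_cst.
apply: (smooth_on_ext oA _
  (smooth_on_linear_comp oA lZ (lift_rep_smooth mN cN sZ s0))).
by move=> z; rewrite (tangent_chart_image mN) => /local_rep_rotating ->.
Qed.

Lemma base_rep_chart i (X : M -> 'rV[R]_n) (u : M) : dom i u.1 ->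
  base_rep i X (chart (c := M) i u) = tcoord i u.1 (X u).
Proof. by move=> iu; rewrite /base_rep (tangent_paramK mN iu). Qed.

(** * Brackets and Lie derivatives at a point of TN *)

Section at_point.
Variables (p : N) (w : 'rV[R]_n).
Let i := pref p.
Let ip : dom i p := prefP mN p.
Let x0 := chart i p.
Let z0 : 'rV[R]_(n + n) := row_mx x0 w.
Let u0 : M := (p, w).
Let c := christoffel_in (nabla := nabla) i p.
Let zeta : 'rV[R]_(n + n) := row_mx (Z p) (- c (Z p) w).

Lemma base_rep_pref (X : M -> 'rV[R]_n) : base_rep i X z0 = X u0.
Proof.
rewrite /z0 -(tangent_chart_pref mN) base_rep_chart //.
exact: tcoord_pref.
Qed.

Lemma near_base (P : 'rV[R]_(n + n) -> Prop) :
  (forall z, (chart i @` (dom i)) (lsubmx z) -> P z) -> \forall z \near z0, P z.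
Proof.
move=> h; have := near_dom hN (p := p) (P := chart i @` (dom i)).
have H q : dom i q -> (chart i @` (dom i)) (chart i q) by exists q.
move=> /(_ H); rewrite -{1}(row_mxKl (chart (pref p) p) w) => /near_lsubmx.
by apply: filterS => z; exact: h.
Qed.

Lemma hlift_pref v : hlift nabla u0 v = row_mx v (- c v w).
Proof. by rewrite /hlift /christoffel (nabla_coord_field hN). Qed.

Lemma lie_bracket_rotating (X V : M -> 'rV[R]_n) :
  differentiable (base_rep i X) z0 -> differentiable (base_rep i V) z0 ->
  lie_bracket rotating_field
    (fun u => hlift nabla u (X u) + vlift u (V u)) u0 =
  hlift nabla u0
    (2 *: ('D_zeta (base_rep i X) z0 - 'D_(X u0) (local_rep i Z) x0)) +
  vlift u0 (2 *: ('D_zeta (base_rep i V) z0 + c (Z p) (V u0))).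
Proof.
move=> dX dV.
have px : param i x0 = p by rewrite (manifold_paramK mN ip).
have Gl x b : linear (fun a => G i x a b) by exact: christoffel_in_linearl.
have Gr x a : linear (G i x a) by exact: christoffel_in_linearr.
have dG a b : differentiable (fun x => G i x a b) x0.
  exact: (christoffel_in_differentiable hN p a b).
have dZ : differentiable (local_rep i Z) x0.
  exact: (local_rep_differentiable hN (atlas_openT hN) (J_xi_smooth hN)).
have Zp : local_rep i Z x0 = Z p.
  by rewrite /local_rep px; exact: tcoord_pref.
(* Curvature is tensorial, so coordinate fields with the values [Z p] and [X u0] at [p] are
   enough. *)
have fl := flat_christoffel hN p (Z p) (X u0) w.
have := @bracket_lift_rep R n (G i) Gl Gr x0 w dG (local_rep i Z) 2 dZ _ _ dX dV.
rewrite base_rep_pref base_rep_pref Zp /G px => /(_ fl) B.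
have GE : christoffel_in (nabla := nabla) i p = c by [].
rewrite GE in B.
have -> : hlift nabla u0
    (2 *: ('D_zeta (base_rep i X) z0 - 'D_(X u0) (local_rep i Z) x0)) +
  vlift u0 (2 *: ('D_zeta (base_rep i V) z0 + c (Z p) (V u0))) =
  2 *: (hlift nabla u0 ('D_zeta (base_rep i X) z0 - 'D_(X u0) (local_rep i Z) x0)
    + vlift u0 ('D_zeta (base_rep i V) z0 + c (Z p) (V u0))).
  rewrite (linear_onZ (vlift_linear _)) (linear_onZ (hlift_linear mN cN _)).
  by rewrite -scalerDr.
rewrite [X in _ = _ *: (X + _)]hlift_pref /vlift add_row_mx addr0 [X in row_mx _ X]addrC.
rewrite -[RHS]B /lie_bracket.
have cz : chart (c := M) (pref u0) u0 = z0 by exact: tangent_chart_pref.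
rewrite cz; apply: subr_congr.
  have -> : rotating_field u0 = 2 *: zeta.
    by rewrite /rotating_field /hlift_field hlift_pref.
  by apply: near_eq_derive; apply: near_base => z; exact: local_rep_lift.
have -> : hlift nabla u0 (X u0) + vlift u0 (V u0) =
    lift_rep (G := G i) (base_rep i X) (base_rep i V) z0.
  rewrite hlift_pref /vlift add_row_mx addr0 /lift_rep !base_rep_pref /z0 row_mxKl row_mxKr.
  by rewrite /G px [in RHS]addrC.
by apply: near_eq_derive; apply: near_base => z; exact: local_rep_rotating.
Qed.


Lemma base_rep_J_near (X : M -> 'rV[R]_n) :
  \forall z \near z0, mul_i (base_rep i X z) =
    base_rep i (fun u => J u.1 (X u)) z.
Proof.
apply: near_base => z [q iq e]; rewrite /base_rep.
have pz : (param (c := M) i z).1 = q by rewrite /= -e (manifold_paramK mN iq).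
by rewrite pz (tcoord_J hN).
Qed.

Lemma base_rep_N_near (X : M -> 'rV[R]_n) :
  \forall z \near z0, - base_rep i X z = base_rep i (fun u => - X u) z.
Proof.
apply: near_base => z [q iq e]; rewrite /base_rep.
have pz : (param (c := M) i z).1 = q by rewrite /= -e (manifold_paramK mN iq).
by rewrite pz (linear_onN (tcoord_linear mN iq)).
Qed.

Lemma base_rep_J_is_diff (X : M -> 'rV[R]_n) :
  differentiable (base_rep i X) z0 ->
  is_diff z0 (base_rep i (fun u => J u.1 (X u)))
    (fun v => mul_i ('D_v (base_rep i X) z0)).
Proof.
move=> dX; apply: near_is_diff (base_rep_J_near X) _.
exact: (is_diff_linear_comp mul_i_linear (derive_is_diff dX)).
Qed.

Lemma base_rep_N_is_diff (X : M -> 'rV[R]_n) :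
  differentiable (base_rep i X) z0 ->
  is_diff z0 (base_rep i (fun u => - X u))
    (fun v => - 'D_v (base_rep i X) z0).
Proof.
move=> dX; apply: near_is_diff (base_rep_N_near X) _.
exact: (is_diffN (derive_is_diff dX)).
Qed.

Section field.
Variables (U : set M) (Y : vector_field M).
Hypotheses (sY : smooth_field U Y) (Uu : U u0).
Let X (u : M) := hpart u (Y u).
Let V (u : M) := vpart nabla u (Y u).

Lemma hvpart_field : Y = (fun u => hlift nabla u (X u) + vlift u (V u)).
Proof. by apply/funext => u; rewrite hvpartK. Qed.

Lemma local_rep_lift_rep_near : \forall z \near z0,
  local_rep (N := M) i Y z = lift_rep (G := G i) (base_rep i X) (base_rep i V) z.
Proof.
apply: near_base => z Dz; rewrite {1}hvpart_field.
exact: (local_rep_lift mN cN).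
Qed.

Lemma local_rep_field_differentiable : differentiable (local_rep (N := M) i Y) z0.
Proof.
apply: (smooth_on_differentiable (sY (i := i))).
by exists u0 => //; exact: tangent_chart_pref.
Qed.

Lemma base_rep_hpart_differentiable : differentiable (base_rep i X) z0.
Proof.
have h := is_diff_linear_comp (@lsubmx_linear R n n)
  (derive_is_diff local_rep_field_differentiable).
apply: is_diff_differentiable (near_is_diff _ h).
by apply: filterS local_rep_lift_rep_near => z /= ->; rewrite /lift_rep row_mxKl.
Qed.

(** The lower block of [Y] is V - Gamma(X, w). The Gamma term is differentiable since X is, and
    adding it back recovers V. *)
Lemma base_rep_vpart_differentiable : differentiable (base_rep i V) z0.
Proof.
have h := is_diff_linear_comp (@rsubmx_linear R n n)
  (derive_is_diff local_rep_field_differentiable).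
have hl : is_diff z0 lsubmx lsubmx by exact/rV_linear_is_diff/lsubmx_linear.
have hr : is_diff z0 rsubmx rsubmx by exact/rV_linear_is_diff/rsubmx_linear.
have Gl x b : linear (fun a => G i x a b) by exact: christoffel_in_linearl.
have Gr x a : linear (G i x a) by exact: christoffel_in_linearr.
have dG a b : differentiable (fun x => G i x a b) x0.
  exact: (christoffel_in_differentiable hN p a b).
have hG := is_diff_bilinear Gl Gr dG (row_mxKl _ _ : lsubmx z0 = x0) hl
  (derive_is_diff base_rep_hpart_differentiable) hr.
apply: is_diff_differentiable (near_is_diff _ (is_diffD h hG)).
apply: filterS local_rep_lift_rep_near => z e.
by rewrite fctE /= e /lift_rep row_mxKr subrK.
Qed.

Lemma lie_hyper1 : lie_derivative rotating_field (hyper1 nabla J) Y u0 = 0.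
Proof.
have cl : linear (c (Z p)) by exact: christoffel_in_linearr.
have dX := base_rep_hpart_differentiable; have dV := base_rep_vpart_differentiable.
pose JX (u : M) := J u.1 (X u); pose JV (u : M) := J u.1 (V u).
have hX := base_rep_J_is_diff dX; have hV := base_rep_J_is_diff dV.
have hNV := base_rep_N_is_diff (is_diff_differentiable hV).
have E1 : app_field (hyper1 nabla J) Y =
    (fun u => hlift nabla u (JX u) + vlift u (- JV u)).
  by apply/funext => u; rewrite (linear_onN (vlift_linear u)).
rewrite /lie_derivative E1 {1}hvpart_field.
rewrite (lie_bracket_rotating (is_diff_differentiable hX)
  (is_diff_differentiable hNV)).
rewrite (lie_bracket_rotating dX dV) hyper1E.
rewrite (is_diff_derive _ hX) (is_diff_derive _ hNV) (is_diff_derive _ hV).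
rewrite -(linear_onN (vlift_linear u0)) /JX /JV !(J_mul_i hN).
(* L_Z J = 0 takes care of D_(J X) Z, and nabla_Z J = 0 of Gamma(Z, J V). *)
rewrite (derive_J_xi_mul_i hN) (linear_onN cl).
have cZJ v : c (Z p) (mul_i v) = mul_i (c (Z p) v).
  exact: (christoffel_J_xi hN p v).
rewrite cZJ !(linear_onZ mul_i_linear).
rewrite (linear_onB mul_i_linear) (linear_onD mul_i_linear).
by rewrite -opprD scalerN subrr.
Qed.

Lemma lie_hyper2 : lie_derivative rotating_field (hyper2 nabla) Y u0 =
  - (2 *: hyper3 nabla J u0 (Y u0)).
Proof.
have cl : linear (c (Z p)) by exact: christoffel_in_linearr.
have dX := base_rep_hpart_differentiable; have dV := base_rep_vpart_differentiable.
have hNX := base_rep_N_is_diff dX.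
have E2 : app_field (hyper2 nabla) Y =
    (fun u => hlift nabla u (V u) + vlift u (- X u)).
  by apply/funext => u; rewrite (linear_onN (vlift_linear u)).
have E3 : hyper3 nabla J u0 (Y u0) =
    hlift nabla u0 (mul_i (V u0)) + vlift u0 (mul_i (X u0)).
  by rewrite -!(J_mul_i hN p).
rewrite E3 /lie_derivative E2 {1}hvpart_field.
rewrite (lie_bracket_rotating dV (is_diff_differentiable hNX)).
rewrite (lie_bracket_rotating dX dV) hyper2E.
rewrite (is_diff_derive _ hNX) (linear_onN cl).
(* This is nabla Z = J with the arguments of Gamma exchanged, since the bracket produces Gamma(Z, v)
   and not Gamma(v, Z). *)
have hZ v : mul_i v = 'D_v (local_rep i Z) x0 + c (Z p) v.
  by rewrite (derive_J_xi hN p v) (christoffel_sym hN p v) subrK.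
rewrite (hZ (V u0)) (hZ (X u0)).
by apply: hyper2_algebra; [exact: (hlift_linear mN cN u0)|exact: vlift_linear].
Qed.

End field.

End at_point.

End rotating.

Theorem lemma8p1 (R : realType) (m : nat) (N : chart_space R (m + m))
    (J : endo_field N) (nabla : covariant N) (xi : vector_field N)
    (hN : conical_special_complex_manifold J nabla xi) :
  let Z : vector_field N := app_field J xi in
  rotating_vector_field (M := tangent_bundle N)
    (hyper1 nabla J) (hyper2 nabla) (hyper3 nabla J)
    (fun u => 2 *: hlift_field nabla Z u).
Proof.
move=> Z; split; first exact: (rotating_smooth hN).
- by move=> U Y [p w] oU sY Uu; exact: (lie_hyper1 hN sY Uu).
- by move=> U Y [p w] oU sY Uu; exact: (lie_hyper2 hN sY Uu).
Qed.
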